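(* Let $\mathbb{D}\subset\mathbb{C}$ be the unit disc and $\mathbb{B}_m\subset\mathbb{C}^m$ the unit ball. Let $F:\mathbb{D}\to\mathbb{B}_m$ be holomorphic, and suppose that for a point $\zeta$ with $|\zeta|=1$, $F$ extends to $\zeta$ with $\|F(\zeta)\|=1$ and $F$ is differentiable at $\zeta$. Then $$\|F'(\zeta)\|\ \ge\ \frac{2(1-\|F(0)\|)^2}{\,1-\|F(0)\|^2+\|F'(0)\|\,}.$$ Moreover, with $a=F(0)$, $$\|F'(\zeta)\|\ \ge\ \begin{cases}\dfrac{2(1-\|a\|)^2}{\,1-\|a\|^2+\sqrt{1-\|a\|^2}\,}, & m\ge 2,\\[2mm] \dfrac{1-|a|}{1+|a|}, & m=1.\end{cases}$$
   Context: $\|\cdot\|$ denotes the Euclidean norm on $\mathbb{C}^m$. *)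

(* Defs.v *)
From Stdlib Require Import Reals List.
From Coquelicot Require Import Coquelicot.
Open Scope R_scope.

(* A vector of C^m is represented by v : nat -> C, only indices j < m matter. *)
Definition vnorm (m : nat) (v : nat -> C) : R :=
  sqrt (fold_right Rplus 0 (map (fun j => Cmod (v j) ^ 2) (seq 0 m))).

Definition holo_disc (m : nat) (F F' : nat -> C -> C) : Prop :=
  forall j, (j < m)%nat -> forall z : C, Cmod z < 1 ->
    @is_derive C_AbsRing C_NormedModule (F j) z (F' j z).

Definition maps_into_ball (m : nat) (F : nat -> C -> C) : Prop :=
  forall z : C, Cmod z < 1 -> vnorm m (fun j => F j z) < 1.

Definition boundary_diff (m : nat) (F : nat -> C -> C) (zeta : C) (b d : nat -> C) : Prop :=
  forall eps : R, 0 < eps -> exists delta : R, 0 < delta /\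
    forall z : C, Cmod z < 1 -> Cmod (Cminus z zeta) < delta ->
      vnorm m (fun j => Cminus (Cminus (F j z) (b j)) (Cmult (d j) (Cminus z zeta)))
        <= eps * Cmod (Cminus z zeta).

(* Main.v *)
(* Pairing [F] with the unit vector [b] and rotating [zeta] to [1] gives a holomorphic
   self-map [f] of the disc with [f 1 = 1] and [f' 1 = c], [|c| <= ||d||], for which
   [|f 0|] and [|f' 0|] are at most [||F 0||] and [||F' 0||].  Let
   [p = (1 + f) / (1 - f)], of positive real part.  Harnack's inequality for [Re p]
   gives [|c| >= (1 - |f 0|) / (1 + |f 0|)], whence the bounds depending on [||F 0||]
   only.  Moreover [c > 0] and, comparing [w] with points tending to [1] radially,
   [Re p w >= (1 / c) Re ((1 + w) / (1 - w))].  The difference [q] of the two sides,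
   seen as a holomorphic function, has nonnegative real part, hence
   [|q' 0| <= 2 Re (q 0)], which is the bound involving [f' 0].

   This last inequality, from which Harnack's follows by integration along rays after
   composing with disc automorphisms, is all that is used of Cauchy's theory; it
   follows from Goursat's theorem for rectangles in the coordinate [log z].  No
   continuity of the derivative is available. *)

Require Import Defs.
From Stdlib Require Import Reals List Lra Lia ClassicalEpsilon.
From Coquelicot Require Import Coquelicot.
Open Scope R_scope.

(** * Complex differentiation *)

Definition Cderiv (f : C -> C) (z l : C) : Prop :=
  @is_derive C_AbsRing (AbsRing_NormedModule C_AbsRing) f z l.

Lemma Cderiv_eps (f : C -> C) (z l : C) :
  Cderiv f z l <->
  forall eps, 0 < eps -> exists delta, 0 < delta /\
    forall w : C, Cmod (w - z)%C < delta ->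
      Cmod (f w - f z - l * (w - z))%C <= eps * Cmod (w - z)%C.
Proof.
split.
- intros [_ H] eps He.
  destruct (H z (fun P HP => HP) (mkposreal eps He)) as [d Hd].
  exists d. split; [apply cond_pos|].
  intros w Hw. specialize (Hd w Hw). rewrite (Cmult_comm l). exact Hd.
- intros H. split.
  + apply is_linear_scal_l.
  + intros x Hx.
    rewrite <- (is_filter_lim_locally_unique _ _ Hx).
    intros eps. destruct (H eps (cond_pos eps)) as [d [Hd Hw]].
    exists (mkposreal d Hd). intros w Hb. specialize (Hw w Hb).
    rewrite (Cmult_comm l) in Hw. exact Hw.
Qed.

(** Only the module structure on the target differs, and its norm is [Cmod] in both cases. [Cderiv]
    takes the ring structure because the product rule requires it. *)
Lemma Cderiv_of_module (f : C -> C) (z l : C) :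
  @is_derive C_AbsRing C_NormedModule f z l -> Cderiv f z l.
Proof.
intros [_ H]. split; [apply is_linear_scal_l|]. exact H.
Qed.

Lemma Cderiv_eq (f : C -> C) (z l l' : C) : Cderiv f z l -> l = l' -> Cderiv f z l'.
Proof. now intros H <-. Qed.

Lemma Cderiv_ext (f g : C -> C) (z l : C) :
  (forall w, f w = g w) -> Cderiv f z l -> Cderiv g z l.
Proof. apply (@is_derive_ext C_AbsRing (AbsRing_NormedModule C_AbsRing)). Qed.

Lemma Cderiv_const (c z : C) : Cderiv (fun _ => c) z 0%C.
Proof. apply (@is_derive_const C_AbsRing (AbsRing_NormedModule C_AbsRing)). Qed.

Lemma Cderiv_id (z : C) : Cderiv (fun w => w) z 1%C.
Proof. apply (@is_derive_id C_AbsRing). Qed.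

Lemma Cderiv_plus (f g : C -> C) (z l m : C) :
  Cderiv f z l -> Cderiv g z m -> Cderiv (fun w => f w + g w)%C z (l + m)%C.
Proof. apply (@is_derive_plus C_AbsRing (AbsRing_NormedModule C_AbsRing)). Qed.

Lemma Cderiv_minus (f g : C -> C) (z l m : C) :
  Cderiv f z l -> Cderiv g z m -> Cderiv (fun w => f w - g w)%C z (l - m)%C.
Proof. apply (@is_derive_minus C_AbsRing (AbsRing_NormedModule C_AbsRing)). Qed.

Lemma Cderiv_mult (f g : C -> C) (z l m : C) :
  Cderiv f z l -> Cderiv g z m -> Cderiv (fun w => f w * g w)%C z (l * g z + f z * m)%C.
Proof.
intros Hf Hg. apply (is_derive_mult f g z l m Hf Hg). intros; apply Cmult_comm.
Qed.

Lemma Cderiv_comp (f g : C -> C) (z l m : C) :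
  Cderiv f (g z) l -> Cderiv g z m -> Cderiv (fun w => f (g w)) z (m * l)%C.
Proof. apply (@is_derive_comp C_AbsRing (AbsRing_NormedModule C_AbsRing)). Qed.

Lemma Cmod_minus_sym (z w : C) : Cmod (z - w)%C = Cmod (w - z)%C.
Proof. rewrite <- Cmod_opp. f_equal. ring. Qed.

Lemma Cmod_rev_triangle (z w : C) : Cmod z - Cmod w <= Cmod (z - w)%C.
Proof.
assert (H := Cmod_triangle (z - w)%C w).
replace (z - w + w)%C with z in H by ring. lra.
Qed.

Lemma Cderiv_Cinv (z : C) : z <> 0%C -> Cderiv Cinv z (- / (z * z))%C.
Proof.
intros Hz. apply Cderiv_eps. intros eps He.
assert (H0 := proj1 (Cmod_gt_0 z) Hz).
set (r := Cmod z) in *.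
assert (Hr3 : 0 < r * r * r) by (repeat apply Rmult_lt_0_compat; lra).
(* The first bound keeps [Cmod w] above [r / 2]; the second then makes one factor of the remainder
   [(w - z)^2 / (z^2 w)] small enough. *)
exists (Rmin (r / 2) (eps * (r * r * r) / 2)). split.
{ apply Rmin_glb_lt; [lra|]. apply Rmult_lt_0_compat; [|lra]. now apply Rmult_lt_0_compat. }
intros w Hw.
assert (H1 := Rlt_le_trans _ _ _ Hw (Rmin_l _ _)).
assert (H2 := Rlt_le_trans _ _ _ Hw (Rmin_r _ _)).
assert (H3 := Cmod_rev_triangle z w). rewrite Cmod_minus_sym in H3. fold r in H3.
assert (Hw0 : w <> 0%C) by (apply Cmod_gt_0; lra).
replace (/ w - / z - - / (z * z) * (w - z))%C
  with ((w - z) * (w - z) / (z * z * w))%C by (field; split; assumption).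
rewrite Cmod_div, !Cmod_mult by (repeat apply Cmult_neq_0; assumption). fold r.
set (d := Cmod (w - z)%C) in *. assert (Hd : 0 <= d) by apply Cmod_ge_0.
assert (Hq : 0 < r * r * Cmod w) by (repeat apply Rmult_lt_0_compat; lra).
apply Rmult_le_reg_r with (r * r * Cmod w); [assumption|].
unfold Rdiv. rewrite Rmult_assoc, Rinv_l, Rmult_1_r by lra.
assert (r * r * (r / 2) <= r * r * Cmod w)
  by (apply Rmult_le_compat_l; [apply Rle_0_sqr|lra]).
assert (eps * (r * r * (r/2)) <= eps * (r * r * Cmod w)) by (apply Rmult_le_compat_l; lra).
replace (eps * d * (r * r * Cmod w)) with (d * (eps * (r * r * Cmod w))) by ring.
apply Rmult_le_compat_l; lra.
Qed.

Lemma Cderiv_inv (f : C -> C) (z l : C) :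
  f z <> 0%C -> Cderiv f z l -> Cderiv (fun w => / f w)%C z (- l / (f z * f z))%C.
Proof.
intros Hz Hf. eapply Cderiv_eq; [exact (Cderiv_comp Cinv f z _ l (Cderiv_Cinv _ Hz) Hf)|].
unfold Cdiv. ring.
Qed.

(** * The complex exponential *)

Definition Cexp (w : C) : C := (exp (fst w) * cos (snd w), exp (fst w) * sin (snd w)).

Lemma Cexp_plus (z w : C) : Cexp (z + w)%C = (Cexp z * Cexp w)%C.
Proof.
unfold Cexp, Cmult; simpl. rewrite exp_plus, cos_plus, sin_plus. f_equal; ring.
Qed.

Lemma Cmod_Cexp (w : C) : Cmod (Cexp w) = exp (fst w).
Proof.
unfold Cmod, Cexp; cbn [fst snd].
replace ((exp (fst w) * cos (snd w)) ^ 2 + (exp (fst w) * sin (snd w)) ^ 2)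
  with (exp (fst w) ^ 2 * ((sin (snd w))² + (cos (snd w))²)) by (unfold Rsqr; ring).
rewrite sin2_cos2, Rmult_1_r. apply sqrt_pow2. left; apply exp_pos.
Qed.

Lemma is_derive_eps (f : R -> R) (x l : R) :
  is_derive f x l -> forall eps, 0 < eps -> exists delta, 0 < delta /\
    forall y, Rabs (y - x) < delta -> Rabs (f y - f x - l * (y - x)) <= eps * Rabs (y - x).
Proof.
intros [_ H] eps He.
destruct (H x (fun P HP => HP) (mkposreal eps He)) as [d Hd].
exists d. split; [apply cond_pos|].
intros w Hw. specialize (Hd w Hw). rewrite (Rmult_comm l). exact Hd.
Qed.

Lemma Cmod_le_Rabs (z : C) : Cmod z <= Rabs (fst z) + Rabs (snd z).
Proof.
destruct z as [x y]. replace (x, y) with (RtoC x + Ci * RtoC y)%C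
  by (unfold Cplus, Cmult, Ci, RtoC; simpl; f_equal; ring).
eapply Rle_trans; [apply Cmod_triangle|].
rewrite Cmod_mult, Cmod_Ci, !Cmod_R, Rmult_1_l. simpl.
replace (x + (0 * y - 1 * 0)) with x by ring. replace (0 + (0 * 0 + 1 * y)) with y by ring.
lra.
Qed.

Lemma Rabs_fst_le (z : C) : Rabs (fst z) <= Cmod z.
Proof. eapply Rle_trans; [|apply Rmax_Cmod]. apply Rmax_l. Qed.

Lemma Rabs_snd_le (z : C) : Rabs (snd z) <= Cmod z.
Proof. eapply Rle_trans; [|apply Rmax_Cmod]. apply Rmax_r. Qed.

Lemma Cderiv_Cexp0 : Cderiv Cexp 0%C 1%C.
Proof.
apply Cderiv_eps. intros eps He.
(* The two coordinates of the error will add up to at most [7 * (e * m)]. The cap at 1 serves for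
   [|1 + x| <= 2] and [|sin y| <= 2 m]. *)
set (e := Rmin (eps / 10) 1).
assert (Hep : 0 < e) by (apply Rmin_glb_lt; lra).
assert (He1 : e <= eps / 10) by apply Rmin_l.
assert (He2 : e <= 1) by apply Rmin_r.
clearbody e.
destruct (is_derive_eps _ _ _ (is_derive_exp 0) e Hep) as [d1 [D1 P1]].
destruct (is_derive_eps _ _ _ (is_derive_cos 0) e Hep) as [d2 [D2 P2]].
destruct (is_derive_eps _ _ _ (is_derive_sin 0) e Hep) as [d3 [D3 P3]].
exists (Rmin e (Rmin d1 (Rmin d2 d3))). split.
{ repeat apply Rmin_glb_lt; assumption. }
intros w Hw.
replace (w - 0)%C with w in * by ring.
assert (Hwe := Rlt_le_trans _ _ _ Hw (Rmin_l _ _)).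
assert (H' := Rlt_le_trans _ _ _ Hw (Rmin_r _ _)).
assert (Hw1 := Rlt_le_trans _ _ _ H' (Rmin_l _ _)).
assert (H'' := Rlt_le_trans _ _ _ H' (Rmin_r _ _)).
assert (Hw2 := Rlt_le_trans _ _ _ H'' (Rmin_l _ _)).
assert (Hw3 := Rlt_le_trans _ _ _ H'' (Rmin_r _ _)).
assert (Fx := Rabs_fst_le w). assert (Fy := Rabs_snd_le w).
specialize (P1 (fst w)). specialize (P2 (snd w)). specialize (P3 (snd w)).
rewrite Rminus_0_r in P1, P2, P3.
specialize (P1 ltac:(lra)). specialize (P2 ltac:(lra)). specialize (P3 ltac:(lra)).
rewrite exp_0 in P1. rewrite cos_0, sin_0 in P2. rewrite sin_0, cos_0 in P3.
eapply Rle_trans; [apply Cmod_le_Rabs|].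
unfold Cexp, Cminus, Cplus, Copp, Cmult, RtoC; simpl.
rewrite exp_0, cos_0, sin_0.
set (x := fst w) in *. set (y := snd w) in *. set (m := Cmod w) in *.
set (A := exp x - 1 - 1 * x) in *. set (B := cos y - 1 - - 0 * y) in *.
set (S := sin y - 0 - 1 * y) in *.
assert (Hm : 0 <= m) by apply Cmod_ge_0.
assert (QA : Rabs A <= e * m) by (eapply Rle_trans; [exact P1|apply Rmult_le_compat_l; lra]).
assert (QB : Rabs B <= e * m) by (eapply Rle_trans; [exact P2|apply Rmult_le_compat_l; lra]).
assert (QS : Rabs S <= e * m) by (eapply Rle_trans; [exact P3|apply Rmult_le_compat_l; lra]).
(* Substitute [exp x = A + 1 + x] and [cos y = B + 1]. *)
replace (exp x * cos y + - (1 * 1) + - (1 * x - 0 * y)) with (A * cos y + B * (1 + x))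
  by (unfold A, B; ring).
replace (exp x * sin y + - (1 * 0) + - (1 * y + 0 * x)) with (A * sin y + x * sin y + S)
  by (unfold A, S; ring).
assert (T1 : Rabs (A * cos y + B * (1 + x)) <= 3 * (e * m)).
{ eapply Rle_trans; [apply Rabs_triang|]. rewrite !Rabs_mult.
  assert (Rabs (cos y) <= 1) by (apply Rabs_le; apply COS_bound).
  assert (Rabs (1 + x) <= 2)
    by (eapply Rle_trans; [apply Rabs_triang|]; rewrite Rabs_R1; lra).
  assert (Rabs A * Rabs (cos y) <= (e * m) * 1)
    by (apply Rmult_le_compat; try apply Rabs_pos; assumption).
  assert (Rabs B * Rabs (1 + x) <= (e * m) * 2)
    by (apply Rmult_le_compat; try apply Rabs_pos; assumption).
  lra. }
assert (T2 : Rabs (A * sin y + x * sin y + S) <= 4 * (e * m)).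
{ eapply Rle_trans; [apply Rabs_triang|]. eapply Rle_trans.
  { apply Rplus_le_compat_r. apply Rabs_triang. }
  rewrite !Rabs_mult.
  assert (Rabs (sin y) <= 1) by (apply Rabs_le; apply SIN_bound).
  assert (Rabs (sin y) <= 2 * m).
  { replace (sin y) with (S + y) by (unfold S; ring).
    eapply Rle_trans; [apply Rabs_triang|].
    assert (e * m <= 1 * m) by (apply Rmult_le_compat_r; lra). lra. }
  assert (Rabs A * Rabs (sin y) <= (e * m) * 1)
    by (apply Rmult_le_compat; try apply Rabs_pos; assumption).
  assert (Rabs x * Rabs (sin y) <= e * (2 * m))
    by (apply Rmult_le_compat; try apply Rabs_pos; try assumption; lra).
  lra. }
assert (e * m <= eps / 10 * m) by (apply Rmult_le_compat_r; lra).
assert (0 <= eps * m) by (apply Rmult_le_pos; lra).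
lra.
Qed.

(** Since [Cexp w = Cexp z * Cexp (w - z)], the derivative at 0 determines it everywhere. *)
Lemma Cderiv_Cexp (z : C) : Cderiv Cexp z (Cexp z).
Proof.
assert (Hf : Cderiv (fun w => w - z)%C z (1 - 0)%C)
  by (apply Cderiv_minus; [apply Cderiv_id|apply Cderiv_const]).
assert (H0 : Cderiv Cexp (z - z)%C 1%C).
{ replace (z - z)%C with (0 : C) by ring. exact Cderiv_Cexp0. }
assert (H1 := Cderiv_mult _ _ _ _ _ (Cderiv_const (Cexp z) z) (Cderiv_comp Cexp (fun w => w - z)%C z _ _ H0 Hf)).
simpl in H1. eapply Cderiv_ext; [|eapply Cderiv_eq; [exact H1|ring]].
intros w. simpl. rewrite <- Cexp_plus. f_equal. ring.
Qed.

(** * Goursat's theorem for rectangles *)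

Lemma Cderiv_continuous (f : C -> C) (z l : C) : Cderiv f z l ->
  forall eps, 0 < eps -> exists delta, 0 < delta /\
    forall w, Cmod (w - z)%C < delta -> Cmod (f w - f z)%C < eps.
Proof.
intros H eps He. destruct (proj1 (Cderiv_eps f z l) H 1 Rlt_0_1) as [d [Hd P]].
assert (Hl := Cmod_ge_0 l).
exists (Rmin d (eps / (Cmod l + 2))). split.
{ apply Rmin_glb_lt; [assumption|]. apply Rdiv_lt_0_compat; lra. }
intros w Hw.
assert (H1 := Rlt_le_trans _ _ _ Hw (Rmin_l _ _)).
assert (H2 := Rlt_le_trans _ _ _ Hw (Rmin_r _ _)).
specialize (P w H1).
replace (f w - f z)%C with ((f w - f z - l * (w - z)) + l * (w - z))%C by ring.
eapply Rle_lt_trans; [apply Cmod_triangle|]. rewrite Cmod_mult.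
set (m := Cmod (w - z)%C) in *.
assert (0 <= m) by apply Cmod_ge_0.
assert (m * (Cmod l + 2) < eps).
{ apply Rmult_lt_compat_r with (r := Cmod l + 2) in H2; [|lra].
  unfold Rdiv in H2. rewrite Rmult_assoc, Rinv_l in H2 by lra. lra. }
nra.
Qed.

Lemma Cmod_pair0 (x : R) : Cmod (x, 0) = Rabs x.
Proof. exact (Cmod_R x). Qed.

Lemma Cmod_0pair (x : R) : Cmod (0, x) = Rabs x.
Proof.
replace (0, x) with (Ci * x)%C by (unfold Cmult, Ci, RtoC; simpl; f_equal; ring).
now rewrite Cmod_mult, Cmod_Ci, Cmod_R, Rmult_1_l.
Qed.

Lemma continuous_eps (f : R -> R) (x : R) :
  (forall eps, 0 < eps -> exists delta, 0 < delta /\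
    forall y, Rabs (y - x) < delta -> Rabs (f y - f x) < eps) -> continuous f x.
Proof.
intros H. apply filterlim_locally. intros eps.
destruct (H eps (cond_pos eps)) as [d [Hd P]].
exists (mkposreal d Hd). intros y Hy. exact (P y Hy).
Qed.

Lemma RInt_near_const (f : R -> R) (a b m B : R) :
  a <= b -> ex_RInt f a b -> (forall t, a <= t <= b -> Rabs (f t - m) <= B) ->
  Rabs (RInt f a b - m * (b - a)) <= B * (b - a).
Proof.
intros Hab Hf H.
assert (Hm : ex_RInt (fun _ => m) a b) by apply ex_RInt_const.
assert (E := @RInt_minus R_CompleteNormedModule f (fun _ => m) a b Hf Hm).
rewrite RInt_const in E. change (scal (b - a) m) with ((b - a) * m) in E.
rewrite (Rmult_comm m), (Rmult_comm B).
change (Rabs (minus (RInt f a b) ((b - a) * m)) <= (b - a) * B). rewrite <- E.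
apply abs_RInt_le_const; try assumption.
now apply (@ex_RInt_minus R_NormedModule).
Qed.

(* The imaginary part of the integral of [g] along the boundary of
   [[a,b] x [c,d]]. *)
Definition flux (g : C -> C) (a b c d : R) : R :=
  RInt (fun t => fst (g (b, t)) - fst (g (a, t))) c d
  - RInt (fun s => snd (g (s, d)) - snd (g (s, c))) a b.

Section Goursat.

Variable g : C -> C.
(** Kept abstract so as to serve for a closed rectangle in [goursat] and for the left half-plane,
    the domain of [K (Cexp w)], later. *)
Variable dom : R -> R -> Prop.
Hypothesis g_diff : forall s t, dom s t -> exists l, Cderiv g (s, t) l.

Lemma continuous_vert (b t : R) : dom b t ->
  continuous (fun t => fst (g (b, t))) t /\ continuous (fun t => snd (g (b, t))) t.
Proof.
intros Hb. destruct (g_diff b t Hb) as [l Hl].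
split; apply continuous_eps; intros eps He;
destruct (Cderiv_continuous _ _ _ Hl eps He) as [d [Hd P]]; exists d; (split; [assumption|]);
intros y Hy; specialize (P (b, y));
unfold Cminus, Cplus, Copp in P; simpl in P; rewrite Rplus_opp_r, Cmod_0pair in P;
specialize (P Hy); eapply Rle_lt_trans; try exact P.
- exact (Rabs_fst_le (fst (g (b, y)) + - fst (g (b, t)), _)).
- exact (Rabs_snd_le (_, snd (g (b, y)) + - snd (g (b, t)))).
Qed.

Lemma continuous_horiz (s c : R) : dom s c ->
  continuous (fun s => fst (g (s, c))) s /\ continuous (fun s => snd (g (s, c))) s.
Proof.
intros Hb. destruct (g_diff s c Hb) as [l Hl].
split; apply continuous_eps; intros eps He;
destruct (Cderiv_continuous _ _ _ Hl eps He) as [d [Hd P]]; exists d; (split; [assumption|]);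
intros y Hy; specialize (P (y, c));
unfold Cminus, Cplus, Copp in P; simpl in P; rewrite Rplus_opp_r, Cmod_pair0 in P;
specialize (P Hy); eapply Rle_lt_trans; try exact P.
- exact (Rabs_fst_le (fst (g (y, c)) + - fst (g (s, c)), _)).
- exact (Rabs_snd_le (_, snd (g (y, c)) + - snd (g (s, c)))).
Qed.

Lemma ex_RInt_vert (b c d : R) : c <= d -> (forall t, c <= t <= d -> dom b t) ->
  ex_RInt (fun t => fst (g (b, t))) c d.
Proof.
intros Hcd H. apply (@ex_RInt_continuous R_CompleteNormedModule).
rewrite Rmin_left, Rmax_right by assumption. intros t Ht. now apply continuous_vert, H.
Qed.

Lemma ex_RInt_horiz (c a b : R) : a <= b -> (forall s, a <= s <= b -> dom s c) ->
  ex_RInt (fun s => snd (g (s, c))) a b.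
Proof.
intros Hcd H. apply (@ex_RInt_continuous R_CompleteNormedModule).
rewrite Rmin_left, Rmax_right by assumption. intros t Ht. now apply continuous_horiz, H.
Qed.

Lemma flux_expand (a b c d : R) : a <= b -> c <= d ->
  (forall s t, a <= s <= b -> c <= t <= d -> dom s t) ->
  flux g a b c d =
    RInt (fun t => fst (g (b, t))) c d - RInt (fun t => fst (g (a, t))) c d
    - (RInt (fun s => snd (g (s, d))) a b - RInt (fun s => snd (g (s, c))) a b).
Proof.
intros Hab Hcd H. unfold flux. f_equal.
- apply (@RInt_minus R_CompleteNormedModule);
  (apply ex_RInt_vert; [assumption|]; intros; apply H; lra).
- apply (@RInt_minus R_CompleteNormedModule);
  (apply ex_RInt_horiz; [assumption|]; intros; apply H; lra).
Qed.

(** Each inner side is counted twice with opposite orientations and cancels; the outer sides add up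
    by Chasles' relation. *)
Lemma flux_quarter (a b c d x y : R) : a <= x <= b -> c <= y <= d ->
  (forall s t, a <= s <= b -> c <= t <= d -> dom s t) ->
  flux g a b c d =
    flux g a x c y + flux g x b c y + (flux g a x y d + flux g x b y d).
Proof.
intros Hx Hy H.
rewrite !flux_expand; try lra; try (intros; apply H; lra).
assert (Ev : forall s, a <= s <= b -> RInt (fun t => fst (g (s, t))) c d =
  RInt (fun t => fst (g (s, t))) c y + RInt (fun t => fst (g (s, t))) y d).
{ intros s Hs. symmetry. apply (@RInt_Chasles R_CompleteNormedModule);
  (apply ex_RInt_vert; [lra|]; intros; apply H; lra). }
assert (Eh : forall t, c <= t <= d -> RInt (fun s => snd (g (s, t))) a b =
  RInt (fun s => snd (g (s, t))) a x + RInt (fun s => snd (g (s, t))) x b).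
{ intros t Ht. symmetry. apply (@RInt_Chasles R_CompleteNormedModule);
  (apply ex_RInt_horiz; [lra|]; intros; apply H; lra). }
rewrite (Ev b), (Ev a), (Eh c), (Eh d) by lra. ring.
Qed.

(** The affine part of [g] contributes [fst l * (b - a) * (d - c)] to each of the two integrals, by
    the Cauchy-Riemann equations, and so cancels. What remains is a difference of two errors on each
    pair of opposite sides. *)
Lemma flux_local (a b c d s0 t0 eta : R) (l : C) :
  a <= s0 <= b -> c <= t0 <= d ->
  (forall s t, a <= s <= b -> c <= t <= d -> dom s t) ->
  (forall s t, a <= s <= b -> c <= t <= d ->
    Cmod (g (s, t) - g (s0, t0) - l * ((s, t) - (s0, t0)))%C <= eta) ->
  Rabs (flux g a b c d) <= 2 * eta * ((b - a) + (d - c)).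
Proof.
intros Hs Ht H E.
set (e := fun s t => (g (s, t) - g (s0, t0) - l * ((s, t) - (s0, t0)))%C).
assert (U : forall s t, fst (g (s, t)) = fst (g (s0, t0))
  + (fst l * (s - s0) - snd l * (t - t0)) + fst (e s t)).
{ intros s t. unfold e, Cminus, Cplus, Copp, Cmult; simpl. ring. }
assert (V : forall s t, snd (g (s, t)) = snd (g (s0, t0))
  + (fst l * (t - t0) + snd l * (s - s0)) + snd (e s t)).
{ intros s t. unfold e, Cminus, Cplus, Copp, Cmult; simpl. ring. }
assert (B1 : forall s t, a <= s <= b -> c <= t <= d -> Rabs (fst (e s t)) <= eta).
{ intros. eapply Rle_trans; [apply Rabs_fst_le|]. now apply E. }
assert (B2 : forall s t, a <= s <= b -> c <= t <= d -> Rabs (snd (e s t)) <= eta).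
{ intros. eapply Rle_trans; [apply Rabs_snd_le|]. now apply E. }
assert (I1 := RInt_near_const (fun t => fst (g (b, t)) - fst (g (a, t))) c d
  (fst l * (b - a)) (2 * eta)).
assert (I2 := RInt_near_const (fun s => snd (g (s, d)) - snd (g (s, c))) a b
  (fst l * (d - c)) (2 * eta)).
assert (J1 : ex_RInt (fun t => fst (g (b, t)) - fst (g (a, t))) c d).
{ apply (@ex_RInt_minus R_NormedModule); apply ex_RInt_vert; try lra; intros; apply H; lra. }
assert (J2 : ex_RInt (fun s => snd (g (s, d)) - snd (g (s, c))) a b).
{ apply (@ex_RInt_minus R_NormedModule); apply ex_RInt_horiz; try lra; intros; apply H; lra. }
specialize (I1 ltac:(lra) J1). specialize (I2 ltac:(lra) J2).
unfold flux.
assert (K1 : Rabs (RInt (fun t => fst (g (b, t)) - fst (g (a, t))) c d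
   - fst l * (b - a) * (d - c)) <= 2 * eta * (d - c)).
{ apply I1. intros t Htt. rewrite (U b t), (U a t).
  assert (X := B1 b t ltac:(lra) Htt). assert (Y := B1 a t ltac:(lra) Htt).
  apply Rabs_le_between in X. apply Rabs_le_between in Y. apply Rabs_le_between. lra. }
assert (K2 : Rabs (RInt (fun s => snd (g (s, d)) - snd (g (s, c))) a b
   - fst l * (d - c) * (b - a)) <= 2 * eta * (b - a)).
{ apply I2. intros t Htt. rewrite (V t d), (V t c).
  assert (X := B2 t d Htt ltac:(lra)). assert (Y := B2 t c Htt ltac:(lra)).
  apply Rabs_le_between in X. apply Rabs_le_between in Y. apply Rabs_le_between. lra. }
apply Rabs_le_between in K1. apply Rabs_le_between in K2. apply Rabs_le_between. lra.
Qed.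

End Goursat.

(** The intervals are nested, so every left end lies below every right end, and the supremum of the
    left ends belongs to all of them. *)
Lemma dyadic_intervals_point (u : nat -> R) (h : R) :
  (forall n, u n <= u (S n) <= u n + h / 2 ^ S n) ->
  exists x, forall n, u n <= x <= u n + h / 2 ^ n.
Proof.
intros H.
assert (E : forall n, h / 2 ^ n = h / 2 ^ S n + h / 2 ^ S n).
{ intros n. simpl. field. apply pow_nonzero. lra. }
assert (I : forall n k, u n <= u (n + k)%nat).
{ intros n k. induction k as [|k IH]; [rewrite Nat.add_0_r; lra|].
  rewrite Nat.add_succ_r. specialize (H (n + k)%nat). lra. }
assert (D : forall n k, u (n + k)%nat + h / 2 ^ (n + k) <= u n + h / 2 ^ n).
{ intros n k. induction k as [|k IH]; [rewrite Nat.add_0_r; lra|].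
  rewrite Nat.add_succ_r. specialize (H (n + k)%nat). specialize (E (n + k)%nat). lra. }
assert (P : forall n, 0 <= h / 2 ^ n).
{ intros n. specialize (H n). specialize (E n). lra. }
assert (B : forall n m, u m <= u n + h / 2 ^ n).
{ intros n m. destruct (Nat.le_gt_cases n m) as [L|L].
  - replace m with (n + (m - n))%nat by lia.
    specialize (D n (m - n)%nat). specialize (P (n + (m - n))%nat). lra.
  - specialize (I m (n - m)%nat). replace (m + (n - m))%nat with n in I by lia.
    specialize (P n). lra. }
destruct (completeness (fun y => exists n, y = u n)) as [x [X1 X2]].
- exists (u 0%nat + h / 2 ^ 0). intros y [n ->]. apply B.
- exists (u 0%nat). now exists 0%nat.
- exists x. intros n. split; [apply X1; now exists n|].
  apply X2. intros y [m ->]. apply B.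
Qed.

(** Quadrisection: a rectangle with flux at least [E / 4 ^ n] has a quarter with flux at least
    [E / 4 ^ S n]. The chosen quarters shrink to a point, where differentiability and [flux_local]
    bound the flux by a smaller multiple of [1 / 4 ^ n]. *)
Lemma goursat (g : C -> C) (a b c d : R) : a <= b -> c <= d ->
  (forall s t, a <= s <= b -> c <= t <= d -> exists l, Cderiv g (s, t) l) ->
  flux g a b c d = 0.
Proof.
intros Hab Hcd Hg.
set (dom := fun s t => a <= s <= b /\ c <= t <= d).
assert (Hdom : forall s t, dom s t -> exists l, Cderiv g (s, t) l)
  by (intros s t [Hs Ht]; now apply Hg).
destruct (Req_dec (flux g a b c d) 0) as [|Hne]; [assumption|exfalso].
set (E := Rabs (flux g a b c d)).
assert (HE : 0 < E) by now apply Rabs_pos_lt.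
set (h := b - a). set (k := d - c).
assert (Half : forall x n, x / 2 ^ n = x / 2 ^ S n + x / 2 ^ S n).
{ intros x n. simpl. field. apply pow_nonzero. lra. }
assert (Pos : forall x n, 0 <= x -> 0 <= x / 2 ^ n).
{ intros x n Hx. apply Rdiv_le_0_compat; [assumption|]. apply pow_lt. lra. }
set (bad := fun n (p : R * R) =>
  (a <= fst p /\ fst p + h / 2 ^ n <= b) /\ (c <= snd p /\ snd p + k / 2 ^ n <= d) /\
  E / 4 ^ n <= Rabs (flux g (fst p) (fst p + h / 2 ^ n) (snd p) (snd p + k / 2 ^ n))).
set (sub := fun n (p q : R * R) =>
  fst p <= fst q <= fst p + h / 2 ^ S n /\ snd p <= snd q <= snd p + k / 2 ^ S n).
assert (Step : forall n p, bad n p -> exists q, bad (S n) q /\ sub n p q).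
{ intros n [x y] [Hx [Hy Hf]]. cbn [fst snd] in *.
  assert (Hh := Half h n). assert (Hk := Half k n).
  assert (Ph := Pos h (S n) ltac:(unfold h; lra)).
  assert (Pk := Pos k (S n) ltac:(unfold k; lra)).
  rewrite Hh in Hf, Hx. rewrite Hk in Hf, Hy.
  rewrite (flux_quarter g dom Hdom x _ y _ (x + h / 2 ^ S n) (y + k / 2 ^ S n)) in Hf;
    [|lra|lra|unfold dom; intros; lra].
  rewrite <- !Rplus_assoc in Hf.
  replace (E / 4 ^ n) with (4 * (E / 4 ^ S n)) in Hf
    by (simpl; field; apply pow_nonzero; lra).
  set (hh := h / 2 ^ S n) in *. set (kk := k / 2 ^ S n) in *. set (EE := E / 4 ^ S n) in *.
  destruct (Rle_dec EE (Rabs (flux g x (x + hh) y (y + kk)))) as [K1|K1];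
    [exists (x, y); unfold bad, sub; cbn [fst snd]; repeat split; fold hh kk EE; lra|].
  destruct (Rle_dec EE (Rabs (flux g (x + hh) (x + hh + hh) y (y + kk)))) as [K2|K2];
    [exists (x + hh, y); unfold bad, sub; cbn [fst snd]; repeat split; fold hh kk EE; lra|].
  destruct (Rle_dec EE (Rabs (flux g x (x + hh) (y + kk) (y + kk + kk)))) as [K3|K3];
    [exists (x, y + kk); unfold bad, sub; cbn [fst snd]; repeat split; fold hh kk EE; lra|].
  destruct (Rle_dec EE (Rabs (flux g (x + hh) (x + hh + hh) (y + kk) (y + kk + kk)))) as [K4|K4];
    [exists (x + hh, y + kk); unfold bad, sub; cbn [fst snd]; repeat split; fold hh kk EE; lra|].
  exfalso. apply (Rlt_irrefl (4 * EE)). eapply Rle_lt_trans; [exact Hf|].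
  eapply Rle_lt_trans; [apply Rabs_triang|].
  eapply Rle_lt_trans; [apply Rplus_le_compat_r, Rabs_triang|].
  eapply Rle_lt_trans; [apply Rplus_le_compat_r, Rplus_le_compat_r, Rabs_triang|]. lra. }
(* A choice function on all pairs, returning [p] itself as a default when [p] is not bad, so that
   the corners can be defined by plain recursion. *)
assert (Next : forall n p, { q | bad n p -> bad (S n) q /\ sub n p q }).
{ intros n p. apply constructive_indefinite_description.
  destruct (excluded_middle_informative (bad n p)) as [Hb|Hb].
  - destruct (Step n p Hb) as [q Hq]. now exists q.
  - exists p. contradiction. }
set (corner := fix corner n :=
  match n with O => (a, c) | S n => proj1_sig (Next n (corner n)) end).
assert (Bad : forall n, bad n (corner n)).
{ induction n as [|n IH].
  - unfold bad, h, k. simpl.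
    replace (a + (b - a) / 1) with b by field. replace (c + (d - c) / 1) with d by field.
    fold E. repeat split; lra.
  - simpl. now apply (proj2_sig (Next n (corner n))). }
assert (Sub : forall n, sub n (corner n) (corner (S n))).
{ intros n. simpl. now apply (proj2_sig (Next n (corner n))). }
destruct (dyadic_intervals_point (fun n => fst (corner n)) h) as [s0 Hs0];
  [intros n; apply Sub|].
destruct (dyadic_intervals_point (fun n => snd (corner n)) k) as [t0 Ht0];
  [intros n; apply Sub|].
cbv beta in Hs0, Ht0.
destruct (Hdom s0 t0) as [l Hl].
{ destruct (Bad 0%nat) as [B1 [B2 _]]. specialize (Hs0 0%nat). specialize (Ht0 0%nat).
  split; lra. }
assert (Hhk : 0 <= h + k) by (unfold h, k; lra).
(* [flux_local] will give at most [2 * eta * (h + k)^2 / 4 ^ n], which must fall below [E / 4 ^ n].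
   The added 1 covers the degenerate case [h + k = 0]. *)
set (eta := E / (4 * ((h + k) * (h + k) + 1))).
assert (Hq : 0 < (h + k) * (h + k) + 1) by nra.
assert (Heta : 0 < eta) by (apply Rdiv_lt_0_compat; lra).
destruct (proj1 (Cderiv_eps _ _ _) Hl eta Heta) as [delta [Hdelta P]].
(* [h + k] dominates the diameter, so the whole [n]-th rectangle then lies within [delta] of the
   limit point. *)
assert (Hn : exists n, (h + k) / 2 ^ n < delta).
{ destruct (pow_lt_1_zero (/ 2) ltac:(rewrite Rabs_pos_eq; lra) (delta / (h + k + 1)))
    as [n Pn]; [apply Rdiv_lt_0_compat; lra|].
  exists n. specialize (Pn n (le_n n)). rewrite pow_inv, Rabs_pos_eq in Pn
    by (left; apply Rinv_0_lt_compat, pow_lt; lra).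
  assert (0 < / 2 ^ n) by (apply Rinv_0_lt_compat, pow_lt; lra).
  apply Rmult_lt_compat_r with (r := h + k + 1) in Pn; [|lra].
  replace (delta / (h + k + 1) * (h + k + 1)) with delta in Pn by (field; lra).
  unfold Rdiv. nra. }
destruct Hn as [n Hn]. specialize (Hs0 n). specialize (Ht0 n).
destruct (Bad n) as [B1 [B2 B3]].
set (x := fst (corner n)) in *. set (y := snd (corner n)) in *.
replace ((h + k) / 2 ^ n) with (h / 2 ^ n + k / 2 ^ n) in Hn by (field; apply pow_nonzero; lra).
assert (Near : forall s t, x <= s <= x + h / 2 ^ n -> y <= t <= y + k / 2 ^ n ->
  Cmod ((s, t) - (s0, t0))%C <= h / 2 ^ n + k / 2 ^ n).
{ intros s t Hs Ht. eapply Rle_trans; [apply Cmod_le_Rabs|]. simpl.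
  apply Rplus_le_compat; apply Rabs_le; lra. }
assert (L := flux_local g dom Hdom x (x + h / 2 ^ n) y (y + k / 2 ^ n) s0 t0
  (eta * (h / 2 ^ n + k / 2 ^ n)) l Hs0 Ht0).
assert (L' : Rabs (flux g x (x + h / 2 ^ n) y (y + k / 2 ^ n)) <=
  2 * (eta * (h / 2 ^ n + k / 2 ^ n)) * (x + h / 2 ^ n - x + (y + k / 2 ^ n - y))).
{ apply L.
  - unfold dom. intros; lra.
  - intros s t Hs Ht. specialize (Near s t Hs Ht).
    eapply Rle_trans; [apply P; lra|]. apply Rmult_le_compat_l; lra. }
assert (X := Rle_trans _ _ _ B3 L').
apply (Rlt_irrefl (E / 4 ^ n)). eapply Rle_lt_trans; [exact X|].
replace (4 ^ n) with (2 ^ n * 2 ^ n) by (rewrite <- Rpow_mult_distr; f_equal; lra).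
assert (H2 : 0 < / 2 ^ n) by (apply Rinv_0_lt_compat, pow_lt; lra).
replace (2 * (eta * (h / 2 ^ n + k / 2 ^ n)) * (x + h / 2 ^ n - x + (y + k / 2 ^ n - y)))
  with (2 * eta * ((h + k) * (h + k)) * (/ 2 ^ n * / 2 ^ n))
  by (field; apply pow_nonzero; lra).
replace (E / (2 ^ n * 2 ^ n)) with (4 * eta * ((h + k) * (h + k) + 1) * (/ 2 ^ n * / 2 ^ n))
  by (unfold eta; field; split; [apply pow_nonzero|]; lra).
apply Rmult_lt_compat_r; [nra|]. nra.
Qed.

(** * Holomorphic functions with nonnegative real part *)

(* [K (exp w)] is [2 pi i]-periodic, so Goursat's theorem makes the mean of [Re K]
   over the circle of radius [exp s] independent of [s]; let [s] tend to [-oo]. *)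
Lemma re_limit_nonneg_of_circle (K : C -> C) (L : C) (r : R) :
  (forall z, 0 < Cmod z < 1 -> exists l, Cderiv K z l) ->
  (forall eps, 0 < eps -> exists delta, 0 < delta /\
    forall z, 0 < Cmod z < delta -> Cmod (K z - L)%C < eps) ->
  0 < r < 1 -> (forall z, Cmod z = r -> 0 <= Re (K z)) -> 0 <= Re L.
Proof.
intros HK Hlim [Hr0 Hr1] Hpos.
destruct (Rle_dec 0 (Re L)) as [|Hn]; [assumption|exfalso].
(* With this tolerance [Re K < Re L / 2 < 0] on the inner circle, while [Re K >= 0] on the outer
   one; yet their means must agree. *)
destruct (Hlim (- Re L / 2)) as [delta [Hdelta P]]; [lra|].
set (b := ln r).
assert (Eb : exp b = r) by now apply exp_ln.
assert (Hb : b < 0) by (rewrite <- ln_1; now apply ln_increasing).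
set (a := Rmin b (ln (delta / 2))).
assert (Hab : a <= b) by apply Rmin_l.
assert (Ea : exp a < delta).
{ apply Rle_lt_trans with (delta / 2); [|lra].
  rewrite <- (exp_ln (delta / 2)) by lra.
  destruct (Rle_lt_or_eq_dec _ _ (Rmin_r b (ln (delta / 2)))) as [H|H]; fold a in H.
  - left. now apply exp_increasing.
  - right. now rewrite H. }
set (g := fun w => K (Cexp w)).
set (dom := fun s (t : R) => s < 0).
assert (Hg : forall s t, dom s t -> exists l, Cderiv g (s, t) l).
{ intros s t Hs. destruct (HK (Cexp (s, t))) as [l Hl].
  - rewrite Cmod_Cexp. simpl. split; [apply exp_pos|].
    rewrite <- exp_0. now apply exp_increasing.
  - exists (Cexp (s, t) * l)%C. exact (Cderiv_comp K Cexp _ _ _ Hl (Cderiv_Cexp _)). }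
assert (HPI := PI_RGT_0).
assert (F : flux g a b 0 (2 * PI) = 0).
{ apply goursat; [assumption|lra|]. intros s t Hs _. apply Hg. unfold dom. lra. }
unfold flux in F.
(* The sides [t = 0] and [t = 2 * PI] have the same image under [Cexp]. *)
rewrite (RInt_ext (fun s => snd (g (s, 2 * PI)) - snd (g (s, 0))) (fun _ => 0)) in F.
2:{ intros s _. unfold g, Cexp; cbn [fst snd].
    rewrite cos_2PI, sin_2PI, cos_0, sin_0. apply Rminus_diag. }
rewrite RInt_const in F. change (scal (b - a) 0) with ((b - a) * 0) in F.
assert (I : forall s, s <= b -> ex_RInt (fun t => fst (g (s, t))) 0 (2 * PI)).
{ intros s Hs. apply (ex_RInt_vert g dom Hg); [lra|]. intros; unfold dom; lra. }
assert (Hc : RInt (fun _ => - Re L / 2) 0 (2 * PI) <=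
  RInt (fun t => fst (g (b, t)) - fst (g (a, t))) 0 (2 * PI)).
{ apply RInt_le; [lra|apply ex_RInt_const| |].
  - apply (@ex_RInt_minus R_NormedModule); apply I; lra.
  - intros t _.
    assert (X : 0 <= fst (g (b, t))).
    { apply (Hpos (Cexp (b, t))). now rewrite Cmod_Cexp. }
    assert (Y : Cmod (g (a, t) - L)%C < - Re L / 2).
    { apply P. rewrite Cmod_Cexp. simpl. split; [apply exp_pos|assumption]. }
    assert (Z := Rabs_fst_le (g (a, t) - L)%C).
    apply Rle_lt_trans with (2 := Y), Rabs_lt_between in Z.
    change (fst (g (a, t) - L)%C) with (fst (g (a, t)) + - Re L) in Z. lra. }
rewrite RInt_const in Hc.
change (scal (2 * PI - 0) (- Re L / 2)) with ((2 * PI - 0) * (- Re L / 2)) in Hc.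
assert (0 < PI * (- Re L)) by (apply Rmult_lt_0_compat; lra). lra.
Qed.

Definition holo (p : C -> C) : Prop :=
  forall z, Cmod z < 1 -> exists l, Cderiv p z l.

Lemma Cconj_mult_self (z : C) : (Cconj z * z)%C = RtoC (Cmod z ^ 2).
Proof. rewrite Cmult_comm. symmetry. apply Cmod2_conj. Qed.

(** Averaging [Re p] against the nonnegative kernel [1 + 2 Re (u z)] on [|z| = r] yields
    [Re (p 0 + v l)], where [v] is chosen so that [v l = - r |l| / 2]. Hence [r |l| <= 2 Re (p 0)]
    for every [r < 1]. The average appears as the limit at 0 of a function holomorphic on the
    punctured disc. *)
Lemma half_plane_deriv0 (p : C -> C) (l : C) :
  holo p -> (forall z, Cmod z < 1 -> 0 <= Re (p z)) -> Cderiv p 0%C l ->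
  Cmod l <= 2 * Re (p 0%C).
Proof.
intros Hp Hpos Hl.
destruct (Ceq_dec l 0%C) as [->|Hl0].
{ rewrite Cmod_0. specialize (Hpos 0%C). rewrite Cmod_0 in Hpos. lra. }
assert (Hm := proj1 (Cmod_gt_0 l) Hl0). set (m := Cmod l) in *.
assert (R1 : forall r, 0 < r < 1 -> r * m <= 2 * Re (p 0%C)).
{ intros r Hr.
  set (p0 := p 0%C) in *.
  set (u := (- (l / RtoC (2 * r * m)))%C).
  set (v := (- (Cconj l * RtoC (r / (2 * m))))%C).
  (* On [|z| = r], [v / z] is the conjugate of [u z] and [|u z| = 1/2], so that
     [H z + v (p z - p0) / z] has real part [Re (p z) (1 + 2 Re (u z)) >= 0]. *)
  set (H := fun z => (p z * (1 + u * z) + Cconj p0 * (u * z))%C).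
  assert (HH : forall z l', Cderiv p z l' -> exists l'', Cderiv H z l'').
  { intros z l' Hz. eexists. apply Cderiv_plus.
    - apply Cderiv_mult; [exact Hz|]. apply Cderiv_plus; [apply Cderiv_const|].
      apply Cderiv_mult; [apply Cderiv_const|apply Cderiv_id].
    - apply Cderiv_mult; [apply Cderiv_const|].
      apply Cderiv_mult; [apply Cderiv_const|apply Cderiv_id]. }
  assert (M : 0 <= Re (p0 + v * l)%C).
  { apply (re_limit_nonneg_of_circle (fun z => H z + v * ((p z - p0) * / z))%C _ r).
    - intros z [Hz0 Hz1]. destruct (Hp z Hz1) as [l' Hl'].
      destruct (HH z l' Hl') as [l'' Hl'']. eexists.
      apply Cderiv_plus; [exact Hl''|]. apply Cderiv_mult; [apply Cderiv_const|].
      apply Cderiv_mult.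
      + apply Cderiv_minus; [exact Hl'|apply Cderiv_const].
      + apply Cderiv_Cinv. now apply Cmod_gt_0.
    - intros eps He. destruct (HH _ _ Hl) as [l'' Hl''].
      destruct (Cderiv_continuous _ _ _ Hl'' (eps / 2)) as [d1 [D1 P1]]; [lra|].
      assert (Hv := Cmod_ge_0 v).
      destruct (proj1 (Cderiv_eps _ _ _) Hl (eps / (2 * (Cmod v + 1)))) as [d2 [D2 P2]].
      { apply Rdiv_lt_0_compat; lra. }
      exists (Rmin d1 d2). split; [now apply Rmin_glb_lt|]. intros z [Hz0 Hz].
      assert (Hz1 := Rlt_le_trans _ _ _ Hz (Rmin_l _ _)).
      assert (Hz2 := Rlt_le_trans _ _ _ Hz (Rmin_r _ _)).
      assert (Hzn : z <> 0%C) by now apply Cmod_gt_0.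
      specialize (P1 z). specialize (P2 z).
      replace (z - 0)%C with z in P1, P2 by ring.
      specialize (P1 Hz1). specialize (P2 Hz2). fold p0 in P2.
      replace (H z + v * ((p z - p0) * / z) - (p0 + v * l))%C
        with ((H z - H 0%C) + v * ((p z - p0 - l * z) / z))%C
        by (unfold H; fold p0; field; assumption).
      eapply Rle_lt_trans; [apply Cmod_triangle|].
      rewrite Cmod_mult, Cmod_div by assumption.
      apply Rle_div_l in P2; [|assumption].
      assert (Cmod v * (Cmod (p z - p0 - l * z)%C / Cmod z)
        <= Cmod v * (eps / (2 * (Cmod v + 1)))) by (apply Rmult_le_compat_l; assumption).
      assert (Cmod v * (eps / (2 * (Cmod v + 1))) <= eps / 2).
      { apply Rmult_le_reg_r with (2 * (Cmod v + 1)); [lra|].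
        replace (Cmod v * (eps / (2 * (Cmod v + 1))) * (2 * (Cmod v + 1)))
          with (Cmod v * eps) by (field; lra). nra. }
      lra.
    - exact Hr.
    - intros z Hz.
      assert (Hzn : z <> 0%C) by (apply Cmod_gt_0; lra).
      assert (Hv : (v * / z)%C = Cconj (u * z)).
      { assert (X := Cconj_mult_self z). rewrite Hz in X.
        assert (Y : (/ z)%C = (Cconj z * RtoC (/ r ^ 2))%C).
        { rewrite RtoC_inv by (apply pow_nonzero; lra). rewrite <- X.
          field. split; [assumption|]. intros Q. apply Hzn.
          rewrite <- (Cconj_conj z), Q. unfold Cconj, RtoC; simpl. f_equal; ring. }
        rewrite Y. unfold u, v, Cdiv.
        rewrite <- RtoC_inv by (apply Rgt_not_eq; apply Rmult_lt_0_compat; lra).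
        destruct l as [l1 l2], z as [z1 z2]. unfold Cconj, Cmult, Copp, RtoC; simpl.
        f_equal; field; lra. }
      replace (H z + v * ((p z - p0) * / z))%C with (H z + (v * / z) * (p z - p0))%C by ring.
      rewrite Hv.
      assert (Hu : Cmod (u * z)%C = / 2).
      { rewrite Cmod_mult, Hz. unfold u. rewrite Cmod_opp.
        assert (0 < 2 * r * m) by (apply Rmult_lt_0_compat; lra).
        rewrite Cmod_div, Cmod_R, Rabs_pos_eq;
          [|lra|intros Q; apply (f_equal fst) in Q; simpl in Q; lra].
        fold m. field. lra. }
      unfold H. set (y := (u * z)%C) in *.
      assert (Q := Rabs_fst_le y). rewrite Hu in Q. apply Rabs_le_between in Q.
      (* [Cconj p0 * y] and [Cconj y * p0] are conjugate, so their difference has no real part; this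
         is the purpose of the last term of [H]. *)
      replace (Re (p z * (1 + y) + Cconj p0 * y + Cconj y * (p z - p0))%C)
        with (Re (p z) * (1 + 2 * fst y)).
      2:{ unfold Cconj, Cmult, Cplus, Cminus, Copp, RtoC, Re; simpl. ring. }
      apply Rmult_le_pos; [apply Hpos|]; lra. }
  assert (X : (v * l)%C = RtoC (- (r * m / 2))).
  { unfold v. replace (- (Cconj l * (r / (2 * m))%R) * l)%C
      with (- (Cconj l * l) * RtoC (r / (2 * m)))%C by ring.
    rewrite Cconj_mult_self. fold m. rewrite <- RtoC_opp, <- RtoC_mult. f_equal. field. lra. }
  rewrite X in M. change (Re (p0 + (- (r * m / 2))%R)%C) with (Re p0 + - (r * m / 2)) in M. lra. }
destruct (Rle_dec m (2 * Re (p 0%C))) as [|N]; [assumption|exfalso].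
specialize (Hpos 0%C). rewrite Cmod_0 in Hpos. specialize (Hpos Rlt_0_1).
set (q := Re (p 0%C)) in *.
(* For this radius [r * m] is the midpoint of [2 * q] and [m], hence exceeds [2 * q] if [m] does. *)
specialize (R1 ((2 * q + m) / (2 * m))).
assert (A1 : 0 < (2 * q + m) / (2 * m)) by (apply Rdiv_lt_0_compat; lra).
assert (A2 : (2 * q + m) / (2 * m) < 1) by (apply Rlt_div_l; lra).
specialize (R1 (conj A1 A2)).
replace ((2 * q + m) / (2 * m) * m) with ((2 * q + m) / 2) in R1 by (field; lra). lra.
Qed.

(** * Disc automorphisms and Harnack's inequality *)

Lemma Cmod_sq (z : C) : Cmod z ^ 2 = fst z ^ 2 + snd z ^ 2.
Proof. exact (Cmod2_alt z). Qed.

(** The disc automorphism taking 0 to [w], with inverse [mobius (- w)]. *)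
Definition mobius (w z : C) : C := ((z + w) * / (1 + Cconj w * z))%C.

Lemma one_plus_neq0 (z : C) : Cmod z < 1 -> (1 + z)%C <> 0%C.
Proof.
intros Hz E. assert (X : z = (- (1))%C) by (replace z with (1 + z - 1)%C by ring; rewrite E; ring).
rewrite X, Cmod_m1 in Hz. lra.
Qed.

Lemma Cmod_conj_mult_lt1 (w z : C) : Cmod w < 1 -> Cmod z < 1 -> Cmod (Cconj w * z)%C < 1.
Proof.
intros Hw Hz. rewrite Cmod_mult, Cmod_conj.
assert (A := Cmod_ge_0 w). assert (B := Cmod_ge_0 z). nra.
Qed.

(** Expand [|1 + Cconj w z|^2 - |z + w|^2]. This gives the invariance of the disc and, in
    [cayley_ge_poisson], the rate at which [mobius (- w) z] approaches the circle when [z] does. *)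
Lemma mobius_defect (w z : C) : Cmod w < 1 -> Cmod z < 1 ->
  (1 - Cmod (mobius w z) ^ 2) * Cmod (1 + Cconj w * z)%C ^ 2
  = (1 - Cmod z ^ 2) * (1 - Cmod w ^ 2).
Proof.
intros Hw Hz.
assert (N := one_plus_neq0 _ (Cmod_conj_mult_lt1 w z Hw Hz)).
assert (N' := proj1 (Cmod_gt_0 _) N).
unfold mobius. rewrite Cmod_mult, Cmod_inv by assumption.
replace ((1 - (Cmod (z + w)%C * / Cmod (1 + Cconj w * z)%C) ^ 2) * Cmod (1 + Cconj w * z)%C ^ 2)
  with (Cmod (1 + Cconj w * z)%C ^ 2 - Cmod (z + w)%C ^ 2) by (field; lra).
rewrite !Cmod_sq. destruct w, z. simpl. ring.
Qed.

Lemma mobius_disc (w z : C) : Cmod w < 1 -> Cmod z < 1 -> Cmod (mobius w z) < 1.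
Proof.
intros Hw Hz. assert (D := mobius_defect w z Hw Hz).
assert (N' := proj1 (Cmod_gt_0 _) (one_plus_neq0 _ (Cmod_conj_mult_lt1 w z Hw Hz))).
assert (A := Cmod_ge_0 w). assert (B := Cmod_ge_0 z). assert (E := Cmod_ge_0 (mobius w z)).
assert (0 < (1 - Cmod z ^ 2) * (1 - Cmod w ^ 2)) by (apply Rmult_lt_0_compat; nra).
rewrite <- D in H.
apply Rnot_le_lt. intros Q.
assert (0 < Cmod (1 + Cconj w * z)%C ^ 2) by now apply pow_lt.
assert (1 - Cmod (mobius w z) ^ 2 <= 0) by nra. nra.
Qed.

Lemma Cderiv_mobius (w z : C) : Cmod w < 1 -> Cmod z < 1 ->
  Cderiv (mobius w) z (RtoC (1 - Cmod w ^ 2) / ((1 + Cconj w * z) * (1 + Cconj w * z)))%C.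
Proof.
intros Hw Hz. assert (N := one_plus_neq0 _ (Cmod_conj_mult_lt1 w z Hw Hz)).
eapply Cderiv_eq.
- unfold mobius. apply Cderiv_mult.
  + apply Cderiv_plus; [apply Cderiv_id|apply Cderiv_const].
  + apply Cderiv_inv; [exact N|].
    apply Cderiv_plus; [apply Cderiv_const|].
    apply Cderiv_mult; [apply Cderiv_const|apply Cderiv_id].
- cbv beta. rewrite RtoC_minus, <- Cconj_mult_self. field. exact N.
Qed.

Lemma mobius_0 (w : C) : mobius w 0%C = w.
Proof. unfold mobius. replace (1 + Cconj w * 0)%C with (1 : C) by ring. field. Qed.

Lemma Cconj_opp (w : C) : Cconj (- w)%C = (- Cconj w)%C.
Proof. exact (Copp_conj w). Qed.

Lemma mobius_cancel (w z : C) : Cmod w < 1 -> Cmod z < 1 -> mobius w (mobius (- w) z) = z.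
Proof.
intros Hw Hz.
assert (Hw' : Cmod (- w)%C < 1) by now rewrite Cmod_opp.
assert (N := one_plus_neq0 _ (Cmod_conj_mult_lt1 _ _ Hw' Hz)).
assert (N2 := one_plus_neq0 _ (Cmod_conj_mult_lt1 _ _ Hw (mobius_disc _ _ Hw' Hz))).
assert (N3 : (1 + - (Cconj w * w))%C <> 0%C).
{ apply one_plus_neq0. rewrite Cmod_opp. now apply Cmod_conj_mult_lt1. }
unfold mobius in *. rewrite Cconj_opp in *.
replace (1 + Cconj w * ((z + - w) * / (1 + - Cconj w * z)))%C
  with ((1 + - (Cconj w * w)) / (1 + - Cconj w * z))%C in * by (field; exact N).
field. now split.
Qed.

Lemma holo_comp_mobius (p : C -> C) (w : C) :
  holo p -> Cmod w < 1 -> holo (fun z => p (mobius w z)).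
Proof.
intros Hp Hw z Hz. destruct (Hp _ (mobius_disc w z Hw Hz)) as [l Hl].
eexists. exact (Cderiv_comp p (mobius w) z _ _ Hl (Cderiv_mobius w z Hw Hz)).
Qed.

(** [half_plane_deriv0] for [p] composed with [mobius w], whose derivative at 0 is [1 - |w|^2]. *)
Lemma half_plane_deriv (p : C -> C) (w l : C) :
  holo p -> (forall z, Cmod z < 1 -> 0 <= Re (p z)) -> Cmod w < 1 -> Cderiv p w l ->
  (1 - Cmod w ^ 2) * Cmod l <= 2 * Re (p w).
Proof.
intros Hp Hpos Hw Hl.
assert (Hm : Cderiv (mobius w) 0%C (RtoC (1 - Cmod w ^ 2))).
{ eapply Cderiv_eq; [apply Cderiv_mobius; [assumption|rewrite Cmod_0; lra]|].
  replace (1 + Cconj w * 0)%C with (1 : C) by ring. field. }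
rewrite <- (mobius_0 w) in Hl.
assert (H := half_plane_deriv0 _ _ (holo_comp_mobius p w Hp Hw)
  (fun z Hz => Hpos _ (mobius_disc w z Hw Hz)) (Cderiv_comp p (mobius w) 0%C _ _ Hl Hm)).
cbv beta in H. rewrite mobius_0, Cmod_mult, Cmod_R, Rabs_pos_eq in H; [assumption|].
assert (A := Cmod_ge_0 w). nra.
Qed.

Lemma is_derive_of_eps (f : R -> R) (x l : R) :
  (forall eps, 0 < eps -> exists delta, 0 < delta /\
    forall y, Rabs (y - x) < delta -> Rabs (f y - f x - l * (y - x)) <= eps * Rabs (y - x)) ->
  is_derive f x l.
Proof.
intros H. split; [apply is_linear_scal_l|].
intros y Hy. rewrite <- (is_filter_lim_locally_unique _ _ Hy).
intros eps. destruct (H eps (cond_pos eps)) as [d [Hd Hw]].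
exists (mkposreal d Hd). intros w Hb. specialize (Hw w Hb).
rewrite (Rmult_comm l) in Hw. exact Hw.
Qed.

Lemma is_derive_Re_ray (p : C -> C) (z l : C) (t : R) :
  Cderiv p (t * z)%C l -> is_derive (fun s : R => Re (p (s * z)%C)) t (Re (l * z)%C).
Proof.
intros H. apply is_derive_of_eps. intros eps He.
assert (Hz := Cmod_ge_0 z).
(* Adding 1 avoids a division by zero when [z = 0]. *)
destruct (proj1 (Cderiv_eps _ _ _) H (eps / (Cmod z + 1))) as [d [Hd P]].
{ apply Rdiv_lt_0_compat; lra. }
exists (d / (Cmod z + 1)). split; [apply Rdiv_lt_0_compat; lra|]. intros y Hy.
specialize (P (y * z)%C).
replace (y * z - t * z)%C with (RtoC (y - t) * z)%C in P by (rewrite RtoC_minus; ring).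
rewrite Cmod_mult, Cmod_R in P.
assert (HA := Rabs_pos (y - t)).
assert (Q : Rabs (y - t) * (Cmod z + 1) < d).
{ apply Rmult_lt_compat_r with (r := Cmod z + 1) in Hy; [|lra].
  replace (d / (Cmod z + 1) * (Cmod z + 1)) with d in Hy by (field; lra). assumption. }
specialize (P ltac:(nra)).
replace (Re (p (y * z)%C) - Re (p (t * z)%C) - Re (l * z)%C * (y - t))
  with (fst (p (y * z) - p (t * z) - l * ((y - t)%R * z))%C)
  by (unfold Re, Cminus, Cplus, Copp, Cmult, RtoC; simpl; ring).
eapply Rle_trans; [apply Rabs_fst_le|]. eapply Rle_trans; [exact P|].
replace (eps / (Cmod z + 1) * (Rabs (y - t) * Cmod z))
  with (eps * Rabs (y - t) * (Cmod z / (Cmod z + 1))) by (field; lra).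
rewrite <- (Rmult_1_r (eps * Rabs (y - t))) at 2.
apply Rmult_le_compat_l; [nra|]. apply Rle_div_l; lra.
Qed.

(* Along a ray, [Re p (s z) (1 - s|z|) / (1 + s|z|)] is nonincreasing:
   this is [half_plane_deriv] in integrated form. *)
Lemma harnack (p : C -> C) (z : C) :
  holo p -> (forall z, Cmod z < 1 -> 0 <= Re (p z)) -> Cmod z < 1 ->
  Re (p z) * (1 - Cmod z) <= Re (p 0%C) * (1 + Cmod z).
Proof.
intros Hp Hpos Hz. set (rho := Cmod z) in *.
assert (Hr : 0 <= rho) by apply Cmod_ge_0.
assert (Hin : forall t : R, 0 <= t <= 1 -> Cmod (t * z)%C = t * rho /\ 0 <= t * rho < 1).
{ intros t Ht. rewrite Cmod_mult, Cmod_R, Rabs_pos_eq by lra. fold rho. split; [reflexivity|].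
  nra. }
(* Differentiability only asserts that a derivative exists at each point; [epsilon] picks one along
   the ray. *)
set (D := fun t : R => epsilon (inhabits (RtoC 0)) (Cderiv p (t * z)%C)).
assert (HD : forall t : R, Cmod (t * z)%C < 1 -> Cderiv p (t * z)%C (D t)).
{ intros t Ht. apply epsilon_spec, (Hp _ Ht). }
clearbody D.
set (h := fun t : R => Re (p (t * z)%C) * ((1 - t * rho) * / (1 + t * rho))).
set (dh := fun t : R => Re (D t * z)%C * ((1 - t * rho) * / (1 + t * rho))
  - Re (p (t * z)%C) * (2 * rho / (1 + t * rho) ^ 2)).
assert (Hh : forall t, 0 <= t <= 1 -> is_derive h t (dh t)).
{ intros t Ht. destruct (Hin t Ht) as [E Hlt].
  assert (X := is_derive_Re_ray p z (D t) t (HD t ltac:(lra))).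
  assert (Y : is_derive (fun t => (1 - t * rho) * / (1 + t * rho)) t
    (- (2 * rho / (1 + t * rho) ^ 2))).
  { auto_derive; [lra|]. field. lra. }
  assert (Z := is_derive_mult _ _ t _ _ X Y Rmult_comm).
  refine (eq_ind _ (is_derive h t) Z _ _). unfold dh, plus, mult; simpl. ring. }
destruct (MVT_gen h 0 1 dh) as [c [Hc Ec]].
- intros x Hx. rewrite Rmin_left, Rmax_right in Hx by lra. apply Hh. lra.
- intros x Hx. rewrite Rmin_left, Rmax_right in Hx by lra.
  apply derivable_continuous_pt. exists (dh x). apply is_derive_Reals, Hh. lra.
- rewrite Rmin_left, Rmax_right in Hc by lra.
  destruct (Hin c Hc) as [E Hlt].
  assert (L := half_plane_deriv p _ _ Hp Hpos ltac:(rewrite E; lra) (HD c ltac:(lra))).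
  rewrite E in L.
  (* The derivative bound at [c * z], divided by [(1 + s)^2], says that the second term of [dh]
     outweighs the first. *)
  assert (Hneg : dh c <= 0).
  { unfold dh. set (s := c * rho) in *. set (u := Re (p (c * z)%C)) in *.
    assert (L2 : Re (D c * z)%C <= Cmod (D c) * rho).
    { unfold rho. rewrite <- Cmod_mult. eapply Rle_trans; [apply Rle_abs|apply re_le_Cmod]. }
    assert (L3 : Cmod (D c) * ((1 - s) * / (1 + s)) <= u * (2 / (1 + s) ^ 2)).
    { apply Rmult_le_reg_r with ((1 + s) ^ 2); [apply pow_lt; lra|].
      replace (Cmod (D c) * ((1 - s) * / (1 + s)) * (1 + s) ^ 2)
        with ((1 - s ^ 2) * Cmod (D c)) by (field; lra).
      replace (u * (2 / (1 + s) ^ 2) * (1 + s) ^ 2) with (2 * u) by (field; lra). exact L. }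
    assert (P : 0 <= (1 - s) * / (1 + s)).
    { apply Rmult_le_pos; [lra|]. left. apply Rinv_0_lt_compat. lra. }
    assert (L4 := Rmult_le_compat_r _ _ _ P L2).
    assert (L5 := Rmult_le_compat_r _ _ _ Hr L3).
    replace (u * (2 * rho / (1 + s) ^ 2)) with (u * (2 / (1 + s) ^ 2) * rho) by (field; lra).
    lra. }
  assert (Hfin : h 1 <= h 0) by lra.
  unfold h in Hfin.
  replace (1%R * z)%C with z in Hfin by ring. replace (0%R * z)%C with (0 : C) in Hfin by ring.
  rewrite Rmult_1_l, Rmult_0_l in Hfin.
  apply Rmult_le_compat_r with (r := 1 + rho) in Hfin; [|lra].
  replace (Re (p z) * ((1 - rho) * / (1 + rho)) * (1 + rho)) with (Re (p z) * (1 - rho)) in Hfin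
    by (field; lra).
  replace (Re (p 0%C) * ((1 - 0) * / (1 + 0)) * (1 + rho)) with (Re (p 0%C) * (1 + rho)) in Hfin
    by field.
  exact Hfin.
Qed.

(** Move [w] to 0 by an automorphism: [|z|] becomes the pseudo-hyperbolic distance between [w] and
    [z]. *)
Lemma harnack_two_point (p : C -> C) (w z : C) :
  holo p -> (forall z, Cmod z < 1 -> 0 <= Re (p z)) -> Cmod w < 1 -> Cmod z < 1 ->
  Re (p z) * (1 - Cmod (mobius (- w) z)) <= Re (p w) * (1 + Cmod (mobius (- w) z)).
Proof.
intros Hp Hpos Hw Hz.
assert (H := harnack _ (mobius (- w) z) (holo_comp_mobius p w Hp Hw)
  (fun z Hz => Hpos _ (mobius_disc w z Hw Hz))).
cbv beta in H. rewrite mobius_cancel, mobius_0 in H by assumption.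
apply H, mobius_disc; [now rewrite Cmod_opp|assumption].
Qed.

(** * Self-maps of the disc *)

(** Serves for letting the radial parameter [t], and then the tolerance [eps], tend to 0 in the
    boundary estimates. *)
Lemma right_limit_nonneg (h : R -> R) (d : R) :
  continuous h 0 -> 0 < d -> (forall t, 0 < t < d -> 0 <= h t) -> 0 <= h 0.
Proof.
intros Hc Hd H. apply Rnot_lt_le. intros Hn.
destruct (proj1 (filterlim_locally _ _) Hc (mkposreal (- h 0) ltac:(lra))) as [e He].
assert (Hep := cond_pos e).
set (t := Rmin (e / 2) (d / 2)).
assert (T : 0 < t) by (apply Rmin_glb_lt; lra).
assert (T1 : t <= e / 2) by apply Rmin_l.
assert (T2 : t <= d / 2) by apply Rmin_r.
specialize (H t ltac:(lra)).
assert (B : Rabs (h t - h 0) < - h 0).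
{ apply (He t). change (Rabs (t - 0) < e). rewrite Rminus_0_r, Rabs_pos_eq; lra. }
apply Rabs_lt_between in B. lra.
Qed.

(** It carries the disc to the right half-plane and has its pole at 1; its real part is the Poisson
    kernel with pole 1. *)
Definition cayley (w : C) : C := ((1 + w) * / (1 - w))%C.

Lemma one_minus_neq0 (w : C) : Cmod w < 1 -> (1 - w)%C <> 0%C.
Proof. intros H. apply (one_plus_neq0 (- w)%C). now rewrite Cmod_opp. Qed.

Lemma Re_cayley_mult (w : C) : Cmod w < 1 ->
  Re (cayley w) * Cmod (1 - w)%C ^ 2 = 1 - Cmod w ^ 2.
Proof.
intros H. assert (N := one_minus_neq0 w H).
replace (Re (cayley w) * Cmod (1 - w)%C ^ 2)
  with (Re (cayley w * RtoC (Cmod (1 - w)%C ^ 2))%C) by (unfold Re, Cmult, RtoC; simpl; ring).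
rewrite <- Cconj_mult_self. unfold cayley.
replace ((1 + w) * / (1 - w) * (Cconj (1 - w) * (1 - w)))%C
  with ((1 + w) * Cconj (1 - w))%C by (field; exact N).
rewrite Cmod_sq. unfold Re, Cconj; simpl. ring.
Qed.

Lemma Re_cayley (w : C) : Cmod w < 1 ->
  Re (cayley w) = (1 - Cmod w ^ 2) / Cmod (1 - w)%C ^ 2.
Proof.
intros H. rewrite <- (Re_cayley_mult w H).
assert (N := proj1 (Cmod_gt_0 _) (one_minus_neq0 w H)). field. lra.
Qed.

Lemma Re_cayley_pos (w : C) : Cmod w < 1 -> 0 < Re (cayley w).
Proof.
intros H. rewrite Re_cayley by assumption.
assert (N := proj1 (Cmod_gt_0 _) (one_minus_neq0 w H)). assert (A := Cmod_ge_0 w).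
apply Rdiv_lt_0_compat; [nra|now apply pow_lt].
Qed.

Lemma Cderiv_cayley (f : C -> C) (z l : C) : Cmod (f z) < 1 -> Cderiv f z l ->
  Cderiv (fun z => cayley (f z)) z (2 * l / ((1 - f z) * (1 - f z)))%C.
Proof.
intros H Hl. assert (N := one_minus_neq0 _ H). eapply Cderiv_eq.
- unfold cayley. apply Cderiv_mult.
  + apply Cderiv_plus; [apply Cderiv_const|exact Hl].
  + apply Cderiv_inv; [exact N|]. apply Cderiv_minus; [apply Cderiv_const|exact Hl].
- cbv beta. field. exact N.
Qed.

Lemma holo_cayley (f : C -> C) :
  holo f -> (forall z, Cmod z < 1 -> Cmod (f z) < 1) -> holo (fun z => cayley (f z)).
Proof.
intros Hf Hb z Hz. destruct (Hf z Hz) as [l Hl]. eexists.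
apply Cderiv_cayley; [now apply Hb|exact Hl].
Qed.

(** Rotate [f] so that its value at [z] becomes [A = |f z|], and apply Harnack to its Cayley
    transform. At [z] the real part is then [(1 + A) / (1 - A)]; at 0 it is at most
    [(1 + B) / (1 - B)] with [B = |f 0|]. *)
Lemma self_map_growth (f : C -> C) (z : C) :
  holo f -> (forall z, Cmod z < 1 -> Cmod (f z) < 1) -> Cmod z < 1 ->
  (1 + Cmod (f z)) * (1 - Cmod (f 0%C)) * (1 - Cmod z)
  <= (1 - Cmod (f z)) * (1 + Cmod (f 0%C)) * (1 + Cmod z).
Proof.
intros Hf Hb Hz.
assert (Hu : exists u, Cmod u = 1 /\ (u * f z)%C = RtoC (Cmod (f z))).
{ destruct (Ceq_dec (f z) 0%C) as [E|E].
  - exists 1%C. split; [apply Cmod_1|]. rewrite E, Cmod_0. ring.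
  - assert (P := proj1 (Cmod_gt_0 _) E).
    exists (Cconj (f z) * RtoC (/ Cmod (f z)))%C. split.
    + rewrite Cmod_mult, Cmod_conj, Cmod_R, Rabs_pos_eq
        by (left; now apply Rinv_0_lt_compat). field. lra.
    + replace (Cconj (f z) * RtoC (/ Cmod (f z)) * f z)%C
        with (Cconj (f z) * f z * RtoC (/ Cmod (f z)))%C by ring.
      rewrite Cconj_mult_self, <- RtoC_mult. f_equal. field. lra. }
destruct Hu as [u [Hu1 Huz]].
set (g := fun z => (u * f z)%C).
assert (Hg : holo g).
{ intros w Hw. destruct (Hf w Hw) as [l Hl]. eexists.
  apply Cderiv_mult; [apply Cderiv_const|exact Hl]. }
assert (Hgm : forall w, Cmod (g w) = Cmod (f w)).
{ intros w. unfold g. now rewrite Cmod_mult, Hu1, Rmult_1_l. }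
assert (Hgb : forall w, Cmod w < 1 -> Cmod (g w) < 1).
{ intros w Hw. rewrite Hgm. now apply Hb. }
assert (H := harnack _ z (holo_cayley g Hg Hgb)
  (fun w Hw => Rlt_le _ _ (Re_cayley_pos _ (Hgb w Hw))) Hz).
cbv beta in H.
assert (H01 : Cmod (0%C) < 1) by (rewrite Cmod_0; lra).
assert (X := Re_cayley_mult (g z) (Hgb z Hz)).
assert (Y := Re_cayley_mult (g 0%C) (Hgb _ H01)).
rewrite Hgm in X, Y.
replace (1 - g z)%C with (RtoC (1 - Cmod (f z))) in X
  by (unfold g; rewrite Huz, RtoC_minus; reflexivity).
assert (A1 := Hb z Hz). assert (B1 := Hb _ H01).
assert (A0 := Cmod_ge_0 (f z)). assert (B0 := Cmod_ge_0 (f 0%C)).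
assert (Z0 := Cmod_ge_0 z).
assert (T := Cmod_rev_triangle 1%C (g 0%C)). rewrite Hgm, Cmod_1 in T.
rewrite Cmod_R, Rabs_pos_eq in X by lra.
set (A := Cmod (f z)) in *. set (B := Cmod (f 0%C)) in *. set (rho := Cmod z) in *.
set (S := Re (cayley (g z))) in *. set (S0 := Re (cayley (g 0%C))) in *.
set (D := Cmod (1 - g 0%C)%C) in *.
assert (S0p : 0 < S0) by (apply Re_cayley_pos, Hgb, H01).
assert (X' : S * (1 - A) = 1 + A).
{ apply Rmult_eq_reg_r with (1 - A); [|lra]. rewrite Rmult_assoc.
  replace ((1 - A) * (1 - A)) with ((1 - A) ^ 2) by ring. rewrite X. ring. }
assert (Y' : S0 * (1 - B) <= 1 + B).
{ apply Rmult_le_reg_r with (1 - B); [lra|].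
  replace ((1 + B) * (1 - B)) with (S0 * D ^ 2) by (rewrite Y; ring).
  rewrite Rmult_assoc. apply Rmult_le_compat_l; [lra|]. nra. }
rewrite <- X'.
replace (S * (1 - A) * (1 - B) * (1 - rho)) with ((1 - A) * (1 - B) * (S * (1 - rho))) by ring.
apply Rle_trans with ((1 - A) * (1 - B) * (S0 * (1 + rho))).
- apply Rmult_le_compat_l; [apply Rmult_le_pos; lra|exact H].
- replace ((1 - A) * (1 - B) * (S0 * (1 + rho))) with ((1 - A) * (1 + rho) * (S0 * (1 - B))) by ring.
  replace ((1 - A) * (1 + B) * (1 + rho)) with ((1 - A) * (1 + rho) * (1 + B)) by ring.
  apply Rmult_le_compat_l; [apply Rmult_le_pos; lra|exact Y'].
Qed.

(** * The derivative of a self-map at the boundary fixed point 1 *)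

Section Boundary.

Variables (f : C -> C) (c : C).
Hypothesis f_holo : holo f.
Hypothesis f_disc : forall z, Cmod z < 1 -> Cmod (f z) < 1.
Hypothesis f_bdry : forall eps, 0 < eps -> exists delta, 0 < delta /\
  forall z, Cmod z < 1 -> Cmod (z - 1)%C < delta ->
    Cmod (f z - 1 - c * (z - 1))%C <= eps * Cmod (z - 1)%C.

Lemma radial_expansion (eps : R) : 0 < eps -> exists delta, 0 < delta <= 1 /\
  forall t, 0 < t < delta -> Cmod (RtoC (1 - t)) = 1 - t /\
    Cmod (1 - f (RtoC (1 - t)) - c * RtoC t)%C <= eps * t.
Proof.
intros He. destruct (f_bdry eps He) as [d [Hd P]].
exists (Rmin d 1). split; [split; [apply Rmin_glb_lt; lra|apply Rmin_r]|]. intros t [Ht0 Ht].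
assert (T1 := Rlt_le_trans _ _ _ Ht (Rmin_l _ _)).
assert (T2 := Rlt_le_trans _ _ _ Ht (Rmin_r _ _)).
assert (E : Cmod (RtoC (1 - t)) = 1 - t) by (rewrite Cmod_R, Rabs_pos_eq; lra).
split; [exact E|].
specialize (P (RtoC (1 - t))).
assert (E2 : (RtoC (1 - t) - 1)%C = (- RtoC t)%C) by (rewrite RtoC_minus; ring).
rewrite E, E2, Cmod_opp, Cmod_R, (Rabs_pos_eq t) in P by lra.
specialize (P ltac:(lra) T1).
rewrite <- Cmod_opp.
replace (- (1 - f (1 - t)%R - c * t))%C with (f (1 - t)%R - 1 - c * - t)%C by ring.
exact P.
Qed.

(** Use [self_map_growth] at [1 - t], where [1 - |f| <= (k + eps) t]; divide by [t], then let [t]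
    and [eps] tend to 0. *)
Lemma boundary_deriv_lower :
  1 - Cmod (f 0%C) <= Cmod c * (1 + Cmod (f 0%C)).
Proof.
assert (H01 : Cmod (0%C) < 1) by (rewrite Cmod_0; lra).
assert (B1 := f_disc _ H01). assert (B0 := Cmod_ge_0 (f 0%C)). assert (C0 := Cmod_ge_0 c).
set (B := Cmod (f 0%C)) in *. set (k := Cmod c) in *.
assert (K : forall eps, 0 < eps -> 0 <= (k + eps) * (1 + B) - (1 - B)).
{ intros eps He. destruct (radial_expansion eps He) as [d [Hd P]].
  assert (L := right_limit_nonneg
    (fun t => (k + eps) * (1 + B) * (2 - t) - (2 - (k + eps) * t) * (1 - B)) d).
  cbv beta in L.
  assert (0 <= (k + eps) * (1 + B) * (2 - 0) - (2 - (k + eps) * 0) * (1 - B)); [|lra].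
  apply L; [|lra|].
  - apply (@ex_derive_continuous R_AbsRing R_NormedModule). auto_derive. exact I.
  - intros t Ht. destruct (P t Ht) as [E Q].
    assert (G := self_map_growth f (RtoC (1 - t)) f_holo f_disc ltac:(rewrite E; lra)).
    rewrite E in G. fold B in G.
    assert (T := Cmod_rev_triangle 1%C (f (RtoC (1 - t)))). rewrite Cmod_1 in T.
    assert (U : Cmod (1 - f (RtoC (1 - t)))%C <= (k + eps) * t).
    { replace (1 - f (RtoC (1 - t)))%C
        with ((1 - f (RtoC (1 - t)) - c * RtoC t) + c * RtoC t)%C by ring.
      eapply Rle_trans; [apply Cmod_triangle|].
      rewrite Cmod_mult, Cmod_R, Rabs_pos_eq by lra. fold k. lra. }
    set (A := Cmod (f (RtoC (1 - t)))) in *.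
    replace (1 - (1 - t)) with t in G by ring. replace (1 + (1 - t)) with (2 - t) in G by ring.
    assert (G1 : (1 - A) * (1 + B) * (2 - t) <= (k + eps) * t * (1 + B) * (2 - t)).
    { apply Rmult_le_compat_r; [lra|]. apply Rmult_le_compat_r; lra. }
    assert (G2 : (2 - (k + eps) * t) * (1 - B) * t <= (1 + A) * (1 - B) * t).
    { apply Rmult_le_compat_r; [lra|]. apply Rmult_le_compat_r; lra. }
    apply Rmult_le_reg_r with t; [lra|]. lra. }
assert (L := right_limit_nonneg (fun eps => (k + eps) * (1 + B) - (1 - B)) 1).
cbv beta in L.
assert (0 <= (k + 0) * (1 + B) - (1 - B)); [|lra].
apply L; [|lra|].
- apply (@ex_derive_continuous R_AbsRing R_NormedModule). auto_derive. exact I.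
- intros t Ht. apply K. lra.
Qed.

(* Approach [1] along [1 - t + i k t]. *)
Lemma boundary_deriv_cone (k : R) : - fst c - k * snd c <= 0.
Proof.
apply Rnot_lt_le. intros Hn. set (eta := - fst c - k * snd c) in *.
(* The tolerance below leaves an error of at most [eta * t / 2] against a first-order gain of
   [eta * t] in [Re (f z)], forcing [Re (f z) > 1]. *)
assert (Hk := Rabs_pos k). set (kap := 1 + Rabs k).
destruct (f_bdry (eta / (2 * kap))) as [d [Hd P]].
{ apply Rdiv_lt_0_compat; unfold kap; lra. }
(* The first bound puts [z] within [d] of 1; the second gives
   [|z|^2 = 1 - 2 t + t^2 (1 + k^2) <= 1 - t]. *)
set (t := Rmin (d / (2 * kap)) (1 / (1 + k ^ 2))).
assert (Hk2 : 0 <= k ^ 2) by apply pow2_ge_0.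
assert (T : 0 < t).
{ apply Rmin_glb_lt; apply Rdiv_lt_0_compat; unfold kap; lra. }
assert (T1 : t * (2 * kap) <= d).
{ apply Rle_div_r; [unfold kap; lra|]. apply Rmin_l. }
assert (T2 : t * (1 + k ^ 2) <= 1).
{ apply Rle_div_r; [lra|]. apply Rmin_r. }
clearbody t.
set (z := (1 - t, k * t) : C).
assert (Hz1 : (z - 1)%C = (- t, k * t)).
{ unfold z, Cminus, Cplus, Copp, RtoC; simpl. f_equal; ring. }
assert (Hm : Cmod (z - 1)%C <= t * kap).
{ rewrite Hz1. eapply Rle_trans; [apply Cmod_le_Rabs|]. simpl.
  rewrite Rabs_Ropp, Rabs_mult, (Rabs_pos_eq t) by lra. unfold kap. lra. }
assert (Hz : Cmod z < 1).
{ assert (Y := Cmod_sq z). simpl fst in Y. simpl snd in Y.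
  assert (0 <= Cmod z) by apply Cmod_ge_0.
  assert ((1 - t) ^ 2 + (k * t) ^ 2 < 1).
  { replace ((1 - t) ^ 2 + (k * t) ^ 2) with (1 - 2 * t + t * (t * (1 + k ^ 2))) by ring. nra. }
  nra. }
assert (Q := P z Hz ltac:(unfold kap in *; nra)).
assert (Q2 := Rle_trans _ _ _ (Rabs_fst_le _) Q).
assert (Q3 : eta / (2 * kap) * Cmod (z - 1)%C <= eta / 2 * t).
{ apply Rle_trans with (eta / (2 * kap) * (t * kap)).
  - apply Rmult_le_compat_l; [|exact Hm]. left. apply Rdiv_lt_0_compat; unfold kap; lra.
  - right. field. unfold kap; lra. }
apply Rabs_le_between in Q2.
assert (Q4 : fst (f z - 1 - c * (z - 1))%C = fst (f z) - 1 - eta * t).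
{ rewrite Hz1. unfold eta, Cminus, Cplus, Copp, Cmult, RtoC; simpl. ring. }
rewrite Q4 in Q2.
assert (Q5 := Rle_trans _ _ _ (Rle_abs _) (Rabs_fst_le (f z))).
assert (Q6 := f_disc z Hz). nra.
Qed.

(** The cone inequality holds for every slope, which forces [snd c = 0]: otherwise the slope used
    here makes its left side equal to 1. Slope 0 gives [fst c >= 0], and [boundary_deriv_lower]
    excludes 0. *)
Lemma boundary_deriv_real_pos : c = RtoC (Cmod c) /\ 0 < Cmod c.
Proof.
assert (E : snd c = 0).
{ destruct (Req_dec (snd c) 0) as [|N]; [assumption|exfalso].
  assert (H := boundary_deriv_cone (- (fst c + 1) / snd c)).
  replace (- (fst c + 1) / snd c * snd c) with (- (fst c + 1)) in H by (field; assumption).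
  lra. }
assert (P : 0 <= fst c) by (assert (H := boundary_deriv_cone 0); lra).
assert (X : c = RtoC (fst c)) by (destruct c; simpl in *; now rewrite E).
assert (Y : Cmod c = fst c) by (rewrite X, Cmod_R at 1; now apply Rabs_pos_eq).
rewrite Y. split; [exact X|].
destruct P as [|P]; [assumption|].
assert (L := boundary_deriv_lower). rewrite Y, <- P in L.
assert (B := f_disc 0%C). rewrite Cmod_0 in B. specialize (B Rlt_0_1). lra.
Qed.

(* The representing measure of [Re cayley f] has an atom of mass [1 / c] at [1]. *)
Lemma cayley_ge_poisson (w : C) : Cmod w < 1 ->
  Re (cayley w) <= Cmod c * Re (cayley (f w)).
Proof.
intros Hw. destruct boundary_deriv_real_pos as [Hc Hk]. set (k := Cmod c) in *.
assert (Nw := proj1 (Cmod_gt_0 _) (one_minus_neq0 w Hw)).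
set (D := Cmod (1 - w)%C) in *. set (S := Re (cayley (f w))).
assert (Sp : 0 < S) by (apply Re_cayley_pos, f_disc, Hw).
assert (W0 := Cmod_ge_0 w).
set (W := 1 - Cmod w ^ 2). assert (HW : 0 < W) by (unfold W; nra).
(* Harnack between [w] and [1 - t], combined with [mobius_defect]. At [t = eps = 0] the inequality
   reads [4 W / k <= 4 S D^2], which is the claim. *)
assert (K1 : forall eps, 0 < eps < k -> exists d, 0 < d /\ forall t, 0 < t < d ->
  0 <= 4 * S * (D + t) ^ 2 - (2 * (k - eps) / (k + eps) ^ 2 - t) * (2 - t) * W).
{ intros eps He. destruct (radial_expansion eps (proj1 He)) as [d [Hd P]].
  exists d. split; [lra|]. intros t Ht. destruct (P t Ht) as [E Q].
  set (z := RtoC (1 - t)) in *.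
  assert (Hz : Cmod z < 1) by (rewrite E; lra).
  assert (H := harnack_two_point _ w z (holo_cayley f f_holo f_disc)
    (fun w Hw => Rlt_le _ _ (Re_cayley_pos _ (f_disc w Hw))) Hw Hz).
  cbv beta in H. fold S in H.
  assert (Hw' : Cmod (- w)%C < 1) by now rewrite Cmod_opp.
  assert (Hdef := mobius_defect (- w)%C z Hw' Hz).
  assert (Hmo := mobius_disc _ _ Hw' Hz).
  rewrite Cmod_opp, E in Hdef. fold W in Hdef.
  assert (HM0 := Cmod_ge_0 (mobius (- w) z)).
  assert (U : Cmod (1 + Cconj (- w) * z)%C <= D + t).
  { replace (1 + Cconj (- w) * z)%C with (Cconj (1 - w) + Cconj w * RtoC t)%C.
    - eapply Rle_trans; [apply Cmod_triangle|].
      rewrite Cmod_mult, !Cmod_conj, Cmod_R, Rabs_pos_eq by lra. fold D. nra.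
    - unfold z. rewrite Cminus_conj, Cconj_opp, RtoC_minus.
      replace (Cconj 1) with (RtoC 1) by (unfold Cconj, RtoC; simpl; f_equal; ring). ring. }
  assert (U0 := Cmod_ge_0 (1 + Cconj (- w) * z)%C).
  set (m := Cmod (mobius (- w) z)) in *. set (V := Cmod (1 + Cconj (- w) * z)%C) in *.
  set (Sz := Re (cayley (f z))) in *.
  assert (Hfz := f_disc z Hz).
  assert (Szp : 0 < Sz) by (apply Re_cayley_pos, Hfz).
  (* Near 1, [Re (cayley (f z))] grows like [2 / (k t)]. The exact relation used is
     [cayley + 1 = 2 / (1 - f)]; the added 1 accounts for the [- t]. *)
  assert (Lz : 2 * (k - eps) / (k + eps) ^ 2 - t <= Sz * t).
  { assert (N := proj1 (Cmod_gt_0 _) (one_minus_neq0 _ Hfz)).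
    assert (Y := Re_cayley_mult _ Hfz). fold Sz in Y.
    assert (Q2 := Rle_trans _ _ _ (Rabs_fst_le _) Q).
    rewrite Hc in Q2. apply Rabs_le_between in Q2.
    change (fst (1 - f z - k * t)%C) with (1 - fst (f z) - (k * t - 0 * 0)) in Q2.
    assert (N2 : Cmod (1 - f z)%C <= (k + eps) * t).
    { replace (1 - f z)%C with ((1 - f z - c * RtoC t) + c * RtoC t)%C by ring.
      eapply Rle_trans; [apply Cmod_triangle|].
      rewrite Cmod_mult, Cmod_R, Rabs_pos_eq by lra. fold k. lra. }
    assert (Y2 : (Sz + 1) * Cmod (1 - f z)%C ^ 2 = 2 * (1 - fst (f z))).
    { rewrite Rmult_plus_distr_r, Y, !Cmod_sq. simpl. ring. }
    set (G := Cmod (1 - f z)%C) in *.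
    assert (Y3 : 2 * ((k - eps) * t) <= (Sz + 1) * ((k + eps) * t) ^ 2).
    { apply Rle_trans with ((Sz + 1) * G ^ 2); [lra|].
      apply Rmult_le_compat_l; [lra|]. apply pow_incr. lra. }
    assert (Y4 : 2 * (k - eps) / (k + eps) ^ 2 <= (Sz + 1) * t).
    { apply Rle_div_l; [apply pow_lt; lra|].
      apply Rmult_le_reg_r with t; [lra|].
      replace ((Sz + 1) * t * (k + eps) ^ 2 * t) with ((Sz + 1) * ((k + eps) * t) ^ 2) by ring.
      lra. }
    lra. }
  (* Harnack multiplied by [1 + m], with [1 + m <= 2] used twice. *)
  assert (J1 : Sz * (1 - m ^ 2) <= 4 * S).
  { replace (Sz * (1 - m ^ 2)) with (Sz * (1 - m) * (1 + m)) by ring.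
    apply Rle_trans with (S * (1 + m) * (1 + m)); [apply Rmult_le_compat_r; lra|].
    replace (4 * S) with (S * (2 * 2)) by ring. rewrite Rmult_assoc.
    apply Rmult_le_compat_l; [lra|]. apply Rmult_le_compat; lra. }
  assert (J2 : Sz * ((1 - (1 - t) ^ 2) * W) <= 4 * S * (D + t) ^ 2).
  { rewrite <- Hdef. replace (Sz * ((1 - m ^ 2) * V ^ 2)) with (Sz * (1 - m ^ 2) * V ^ 2) by ring.
    apply Rle_trans with (4 * S * V ^ 2).
    - apply Rmult_le_compat_r; [apply pow2_ge_0|exact J1].
    - apply Rmult_le_compat_l; [lra|]. apply pow_incr. lra. }
  assert (J3 : (2 * (k - eps) / (k + eps) ^ 2 - t) * ((2 - t) * W) <= Sz * t * ((2 - t) * W)).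
  { apply Rmult_le_compat_r; [apply Rmult_le_pos; lra|exact Lz]. }
  replace (Sz * ((1 - (1 - t) ^ 2) * W)) with (Sz * t * ((2 - t) * W)) in J2 by ring.
  lra. }
assert (K2 : forall eps, 0 < eps < k ->
  0 <= 4 * S * (D + 0) ^ 2 - (2 * (k - eps) / (k + eps) ^ 2 - 0) * (2 - 0) * W).
{ intros eps He. destruct (K1 eps He) as [d [Hd P]].
  apply (right_limit_nonneg (fun t =>
    4 * S * (D + t) ^ 2 - (2 * (k - eps) / (k + eps) ^ 2 - t) * (2 - t) * W) d);
    [|exact Hd|exact P].
  apply (@ex_derive_continuous R_AbsRing R_NormedModule). auto_derive. exact I. }
assert (K3 : 0 <= 4 * S * (D + 0) ^ 2 - (2 * (k - 0) / (k + 0) ^ 2 - 0) * (2 - 0) * W).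
{ apply (right_limit_nonneg (fun eps =>
    4 * S * (D + 0) ^ 2 - (2 * (k - eps) / (k + eps) ^ 2 - 0) * (2 - 0) * W) k);
    [|exact Hk|exact K2].
  apply (@ex_derive_continuous R_AbsRing R_NormedModule). auto_derive.
  rewrite Rplus_0_r, Rmult_1_r. apply Rgt_not_eq, Rmult_lt_0_compat; lra. }
replace ((2 * (k - 0) / (k + 0) ^ 2 - 0) * (2 - 0) * W) with (4 * (W / k)) in K3 by (field; lra).
rewrite Re_cayley by assumption. fold D W.
apply Rle_div_l; [now apply pow_lt|].
rewrite Rplus_0_r in K3.
assert (Z : W / k <= S * D ^ 2) by lra.
apply (proj1 (Rle_div_l _ _ _ Hk)) in Z. lra.
Qed.

(** By [cayley_ge_poisson], [q = |c| cayley f - cayley] has nonnegative real part, so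
    [half_plane_deriv0] applies. With [G = |1 - f 0|] and [|q' 0| >= 2 - 2 |c| |l| / G^2], it gives
    [2 G^2 <= |c| (1 - |f 0|^2 + |l|)], and [G >= 1 - |f 0|]. *)
Lemma boundary_deriv_lower_deriv0 (l : C) : Cderiv f 0%C l ->
  2 * (1 - Cmod (f 0%C)) ^ 2 <= Cmod c * (1 - Cmod (f 0%C) ^ 2 + Cmod l).
Proof.
intros Hl. destruct boundary_deriv_real_pos as [Hc Hk].
assert (H01 : Cmod (0%C) < 1) by (rewrite Cmod_0; lra).
assert (Hf0 := f_disc _ H01).
assert (Hq : forall z l', Cmod z < 1 -> Cderiv f z l' ->
  Cderiv (fun z => RtoC (Cmod c) * cayley (f z) - cayley z)%C z
    (Cmod c * (2 * l' / ((1 - f z) * (1 - f z))) - 2 * 1 / ((1 - z) * (1 - z)))%C).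
{ intros z l' Hz Hl'. apply Cderiv_minus.
  - eapply Cderiv_eq.
    + apply Cderiv_mult; [apply Cderiv_const|].
      apply Cderiv_cayley; [now apply f_disc|exact Hl'].
    + cbv beta. ring.
  - apply (Cderiv_cayley (fun z => z)); [exact Hz|apply Cderiv_id]. }
assert (D := half_plane_deriv0 (fun z => RtoC (Cmod c) * cayley (f z) - cayley z)%C
  (Cmod c * (2 * l / ((1 - f 0%C) * (1 - f 0%C))) - 2)%C).
assert (R0 : forall z, Re (RtoC (Cmod c) * cayley (f z) - cayley z)%C
   = Cmod c * Re (cayley (f z)) - Re (cayley z))
  by (intros z; unfold Re, Cminus, Cplus, Copp, Cmult, RtoC; simpl; ring).
cbv beta in D. rewrite R0 in D.
assert (D' : Cmod (Cmod c * (2 * l / ((1 - f 0%C) * (1 - f 0%C))) - 2)%C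
  <= 2 * (Cmod c * Re (cayley (f 0%C)) - Re (cayley 0%C))).
{ apply D.
  - intros z Hz. destruct (f_holo z Hz) as [l' Hl']. eexists. exact (Hq z l' Hz Hl').
  - intros z Hz. rewrite R0. assert (P := cayley_ge_poisson z Hz). lra.
  - eapply Cderiv_eq; [apply (Hq 0%C l H01 Hl)|].
    replace (1 - 0)%C with (1 : C) by ring. field. now apply one_minus_neq0. }
clear D.
assert (N := one_minus_neq0 _ Hf0). assert (N' := proj1 (Cmod_gt_0 _) N).
rewrite Cmod_minus_sym in D'.
assert (T := Rle_trans _ _ _ (Cmod_rev_triangle _ _) D').
rewrite Re_cayley in T by assumption. rewrite (Re_cayley _ H01) in T.
replace (1 - 0)%C with (1 : C) in T by ring.
rewrite Cmod_0, Cmod_1, !Cmod_mult, Cmod_div, !Cmod_mult, !Cmod_R in T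
  by (now apply Cmult_neq_0).
rewrite (Rabs_pos_eq (Cmod c)), (Rabs_pos_eq 2) in T by lra.
set (k := Cmod c) in *. set (G := Cmod (1 - f 0%C)%C) in *. set (m := Cmod l) in *.
assert (T1 := Cmod_rev_triangle 1%C (f 0%C)). rewrite Cmod_1 in T1. fold G in T1.
set (B := Cmod (f 0%C)) in *.
apply Rle_trans with (2 * G ^ 2); [apply Rmult_le_compat_l; [lra|apply pow_incr; lra]|].
assert (T2 : 2 <= k * (1 - B ^ 2 + m) / G ^ 2).
{ replace (k * (1 - B ^ 2 + m) / G ^ 2)
    with (k * ((1 - B ^ 2) / G ^ 2) + k * (2 * m / (G * G)) / 2) by (field; lra).
  lra. }
apply Rle_div_r in T2; [exact T2|now apply pow_lt].
Qed.

End Boundary.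

(** * Maps into the ball *)

(** A general index list replaces [seq 0 m] so that induction on it is possible. *)
Definition normsq (L : list nat) (v : nat -> C) : R :=
  fold_right Rplus 0 (map (fun j => Cmod (v j) ^ 2) L).

(** The conjugate falls on [b], so that pairing with a fixed [b] preserves holomorphy in [v]. *)
Definition dot (L : list nat) (b v : nat -> C) : C :=
  fold_right Cplus 0%C (map (fun j => Cconj (b j) * v j)%C L).

Lemma normsq_nonneg (L : list nat) (v : nat -> C) : 0 <= normsq L v.
Proof.
unfold normsq. induction L as [|j L IH]; simpl fold_right; [lra|].
apply Rplus_le_le_0_compat; [apply pow2_ge_0|exact IH].
Qed.

(** Cauchy-Schwarz by induction: the step is [x y + sqrt (P Q) <= sqrt ((x^2 + P) (y^2 + Q))], whose
    cross terms are compared by the inequality of arithmetic and geometric means. *)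
Lemma Cmod_dot_le (L : list nat) (b v : nat -> C) :
  Cmod (dot L b v) <= sqrt (normsq L b) * sqrt (normsq L v).
Proof.
rewrite <- sqrt_mult by apply normsq_nonneg.
induction L as [|j L IH].
- unfold dot; simpl. rewrite Cmod_0. apply sqrt_pos.
- change (dot (j :: L) b v) with (Cconj (b j) * v j + dot L b v)%C.
  change (normsq (j :: L) b) with (Cmod (b j) ^ 2 + normsq L b).
  change (normsq (j :: L) v) with (Cmod (v j) ^ 2 + normsq L v).
  eapply Rle_trans; [apply Cmod_triangle|]. rewrite Cmod_mult, Cmod_conj.
  assert (B := normsq_nonneg L b). assert (V := normsq_nonneg L v).
  assert (HS := sqrt_pos (normsq L b * normsq L v)).
  assert (E := sqrt_sqrt (normsq L b * normsq L v) (Rmult_le_pos _ _ B V)).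
  set (s := sqrt (normsq L b * normsq L v)) in *.
  set (x := Cmod (b j)). set (y := Cmod (v j)).
  assert (x0 : 0 <= x) by apply Cmod_ge_0. assert (y0 : 0 <= y) by apply Cmod_ge_0.
  apply Rle_trans with (x * y + s); [lra|].
  rewrite <- (sqrt_pow2 (x * y + s)) by (apply Rplus_le_le_0_compat; [now apply Rmult_le_pos|lra]).
  apply sqrt_le_1_alt.
  set (P := normsq L b) in *. set (Q := normsq L v) in *.
  assert (AM : 2 * (x * y * s) <= x ^ 2 * Q + P * y ^ 2).
  { assert (X : (2 * (x * y * s)) ^ 2 <= (x ^ 2 * Q + P * y ^ 2) ^ 2).
    { replace ((2 * (x * y * s)) ^ 2) with (4 * (x ^ 2 * y ^ 2 * (s * s))) by ring.
      rewrite E. assert (Z := pow2_ge_0 (x ^ 2 * Q - P * y ^ 2)). nra. }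
    assert (0 <= x ^ 2 * Q + P * y ^ 2).
    { apply Rplus_le_le_0_compat; apply Rmult_le_pos; try assumption; apply pow2_ge_0. }
    apply Rsqr_incr_0_var; [unfold Rsqr; lra|assumption]. }
  lra.
Qed.

Lemma Cmod_dot_le_vnorm (m : nat) (b v : nat -> C) :
  vnorm m b = 1 -> Cmod (dot (seq 0 m) b v) <= vnorm m v.
Proof.
intros Hb. assert (H := Cmod_dot_le (seq 0 m) b v).
change (sqrt (normsq (seq 0 m) b)) with (vnorm m b) in H. rewrite Hb, Rmult_1_l in H. exact H.
Qed.

Lemma dot_self (L : list nat) (b : nat -> C) : dot L b b = RtoC (normsq L b).
Proof.
induction L as [|j L IH]; [reflexivity|].
change (dot (j :: L) b b) with (Cconj (b j) * b j + dot L b b)%C.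
change (normsq (j :: L) b) with (Cmod (b j) ^ 2 + normsq L b).
now rewrite IH, Cconj_mult_self, RtoC_plus.
Qed.

Lemma dot_affine (L : list nat) (b u v w : nat -> C) (x : C) :
  dot L b (fun j => u j - v j - w j * x)%C = (dot L b u - dot L b v - dot L b w * x)%C.
Proof.
unfold dot. induction L as [|j L IH]; simpl; [ring|]. rewrite IH. ring.
Qed.

Lemma Cderiv_dot (L : list nat) (b : nat -> C) (F : nat -> C -> C) (z : C) (d : nat -> C) :
  (forall j, In j L -> Cderiv (F j) z (d j)) ->
  Cderiv (fun w => dot L b (fun j => F j w)) z (dot L b d).
Proof.
unfold dot. induction L as [|j L IH]; intros H; simpl.
- apply Cderiv_const.
- apply Cderiv_plus.
  + eapply Cderiv_eq; [apply Cderiv_mult; [apply Cderiv_const|apply H; now left]|]. cbv beta. ring.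
  + apply IH. intros i Hi. apply H. now right.
Qed.

Theorem theorem2p4 (m : nat) (Hm : (1 <= m)%nat) (F F' : nat -> C -> C)
  (Hholo : holo_disc m F F') (Hball : maps_into_ball m F)
  (zeta : C) (Hzeta : Cmod zeta = 1) (b d : nat -> C)
  (Hb : vnorm m b = 1) (Hdiff : boundary_diff m F zeta b d) :
  let a := vnorm m (fun j => F j 0%C) in
  let a' := vnorm m (fun j => F' j 0%C) in
  2 * (1 - a) ^ 2 / (1 - a ^ 2 + a') <= vnorm m d /\
  ((2 <= m)%nat -> 2 * (1 - a) ^ 2 / (1 - a ^ 2 + sqrt (1 - a ^ 2)) <= vnorm m d) /\
  (m = 1%nat -> (1 - a) / (1 + a) <= vnorm m d).
Proof.
intros a a'.
assert (Hrot : forall z, Cmod (zeta * z)%C = Cmod z)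
  by (intros z; now rewrite Cmod_mult, Hzeta, Rmult_1_l).
set (L := seq 0 m).
set (f := fun z => dot L b (fun j => F j (zeta * z)%C)).
assert (f_deriv : forall z, Cmod z < 1 ->
  Cderiv f z (zeta * dot L b (fun j => F' j (zeta * z)%C))%C).
{ intros z Hz.
  apply (Cderiv_comp (fun w => dot L b (fun j => F j w)) (fun w => zeta * w)%C).
  - apply Cderiv_dot. intros j Hj. apply Cderiv_of_module, Hholo.
    + apply in_seq in Hj. lia.
    + now rewrite Hrot.
  - eapply Cderiv_eq; [apply Cderiv_mult; [apply Cderiv_const|apply Cderiv_id]|]. cbv beta. ring. }
assert (f_holo : holo f) by (intros z Hz; eexists; now apply f_deriv).
assert (f_disc : forall z, Cmod z < 1 -> Cmod (f z) < 1).
{ intros z Hz. eapply Rle_lt_trans; [now apply Cmod_dot_le_vnorm|].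
  apply Hball. now rewrite Hrot. }
(* The factor [zeta] comes from the chain rule for the rotation. *)
set (c := (dot L b d * zeta)%C).
assert (Hnb : normsq L b = 1).
{ rewrite <- (sqrt_sqrt (normsq L b)) by apply normsq_nonneg.
  change (sqrt (normsq L b)) with (vnorm m b). rewrite Hb. ring. }
assert (f_bdry : forall eps, 0 < eps -> exists delta, 0 < delta /\
  forall z, Cmod z < 1 -> Cmod (z - 1)%C < delta ->
    Cmod (f z - 1 - c * (z - 1))%C <= eps * Cmod (z - 1)%C).
{ intros eps He. destruct (Hdiff eps He) as [delta [Hd P]]. exists delta.
  split; [exact Hd|]. intros z Hz Hz1. specialize (P (zeta * z)%C).
  replace (zeta * z - zeta)%C with (zeta * (z - 1))%C in P by ring.
  rewrite !Hrot in P. specialize (P Hz Hz1).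
  eapply Rle_trans; [|exact P].
  eapply Rle_trans; [|apply Cmod_dot_le_vnorm; exact Hb]. fold L.
  (* [dot L b b = 1] is the boundary value of [f] at 1. *)
  rewrite dot_affine, dot_self, Hnb. right. f_equal. unfold f, c. ring. }
assert (H01 : Cmod (0%C) < 1) by (rewrite Cmod_0; lra).
assert (Ez : (zeta * 0)%C = 0%C) by ring.
assert (HA : Cmod (f 0%C) <= a).
{ unfold f. rewrite Ez. now apply Cmod_dot_le_vnorm. }
assert (Ha1 : a < 1) by now apply (Hball 0%C).
assert (Hc : Cmod c <= vnorm m d).
{ unfold c. rewrite Cmult_comm, Hrot. now apply Cmod_dot_le_vnorm. }
assert (Hl : Cmod (zeta * dot L b (fun j => F' j (zeta * 0)))%C <= a').
{ rewrite Hrot, Ez. now apply Cmod_dot_le_vnorm. }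
assert (S1 := boundary_deriv_lower f c f_holo f_disc f_bdry).
assert (S2 := boundary_deriv_lower_deriv0 f c f_holo f_disc f_bdry _ (f_deriv 0%C H01)).
set (l := Cmod (zeta * dot L b (fun j => F' j (zeta * 0)))%C) in *.
assert (A0 := Cmod_ge_0 (f 0%C)). assert (C0 := Cmod_ge_0 c).
assert (L0 : 0 <= l) by apply Cmod_ge_0.
set (A := Cmod (f 0%C)) in *. set (D := vnorm m d) in *. set (k := Cmod c) in *.
clearbody a a' A D k l.
(* [(1 - x) / (1 + x)] decreases in [x], so [A] may be replaced by the larger [a]. *)
assert (M1 : 1 - a <= D * (1 + a)).
{ apply Rle_trans with (1 - A); [lra|]. apply (Rle_trans _ _ _ S1).
  apply Rmult_le_compat; lra. }
assert (Ha : 0 < 1 - a ^ 2) by nra.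
split; [|split].
- apply Rle_div_l; [lra|].
  assert (HA2 : 0 < 1 - A ^ 2) by nra.
  assert (T1 : 2 * (1 - A) ^ 2 <= D * (1 - A ^ 2 + a')).
  { apply (Rle_trans _ _ _ S2). apply Rmult_le_compat; lra. }
  apply Rmult_le_reg_r with (1 - A ^ 2 + a'); [lra|].
  apply Rle_trans with (2 * (1 - A) ^ 2 * (1 - a ^ 2 + a')).
  (* [(1 - x)^2 / (1 - x^2 + a')] also decreases in [x]: after cross-multiplication, the difference
     of its values at [A] and [a] is the sum of these two terms. *)
  + assert (0 <= (1 - A) * (1 - a) * (2 * (a - A)))
      by (repeat apply Rmult_le_pos; lra).
    assert (0 <= a' * ((a - A) * (2 - A - a))) by (repeat apply Rmult_le_pos; lra).
    nra.
  + assert (T2 := Rmult_le_compat_r (1 - a ^ 2 + a') _ _ ltac:(lra) T1). lra.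
- intros _.
  assert (Hs := sqrt_pos (1 - a ^ 2)).
  assert (Es := sqrt_sqrt (1 - a ^ 2) ltac:(lra)).
  set (s := sqrt (1 - a ^ 2)) in *.
  (* A number in [[0, 1]] is at most its square root. The denominator is thus at least
     [2 (1 - a^2)], and the quotient at most [(1 - a) / (1 + a)], which [M1] controls. *)
  assert (Hs1 : 1 - a ^ 2 <= s) by nra.
  apply Rle_div_l; [lra|].
  assert (HD : 0 <= D) by nra.
  apply Rle_trans with (2 * (1 - a) * (D * (1 + a))); [nra|].
  replace (2 * (1 - a) * (D * (1 + a))) with (D * (2 * (1 - a ^ 2))) by ring.
  apply Rmult_le_compat_l; lra.
- intros _. apply Rle_div_l; lra.
Qed.
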